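(* Assume (HC2), (HC3) and (HC4) from the context and let $x^*=(p_0^*,p_1^*,p_2^H(p_0^*,p_1^* ),0)$ be the unique point at which the curves $p_0\mapsto(p_0,p_1(p_0))$ and $p_1\mapsto(p_0(p_1),p_1)$ intersect, i.e. $p_1^*=p_1(p_0^* )$, $p_0^*=p_0(p_1^* )$. If $k\ge2$ is even, $\frac{\partial H}{\partial p_0}(x^* )\ne0$, $h_{fp}'(p_0^* )>0$ and $h_b''(p_1^* )>0$, then $f_h^2$, where $f_h(p,q)=\pi_{(p,q)}\mathcal P(p_0(h,p,q),p,q)$, has a period $k$-tupling bifurcation (with parameter $h$, with respect to the predicate $\mathcal C_R$) at $s(x^* )$.
   Context: Notation. $\mathrm{Fix}(g,U,\mathcal C)=\{x\in U:g(x)=x\text{ and }\mathcal C(x)\}$ for a map $g$, set $U$ and predicate $\mathcal C$; $\mathrm{Fix}(g,U)$ when there is no constraint. $\mathcal C_R(x)$ is the predicate ''$R(x)=x$''. $\pi$ with a subscript denotes projection onto the indicated coordinates. Sums and products of sets of reals are elementwise. Definition (period $k$-tupling). Let $g_\nu$ be a one-parameter family of maps with open domain $N\subset\mathbb R\times X$, $\mathcal C$ a predicate on $X$, $k$ a positive integer. $g_\nu$ has a period $k$-tupling bifurcation at $(\nu^*,x^* )\in N$ if there are $V=[\nu_1,\nu_2]\times U'\subset N$ with $(\nu^*,x^* )\in\mathrm{int}\,V$ and functions $x_{fp}\colon[\nu_1,\nu_2]\to\mathrm{int}\,U'$, $x_{b_1},x_{b_2}\colon[\nu^*,\nu_2]\to\mathrm{int}\,U'$,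 continuous and smooth in the interior of their domains, with $x_{b_1}(\nu^* )=x_{b_2}(\nu^* )=x_{fp}(\nu^* )=x^*$, such that (1) $\mathrm{Fix}(g_\nu^p,U',\mathcal C)=\{x_{fp}(\nu)\}$ for $\nu\in[\nu_1,\nu^*]$, $1\le p\le k$; $\mathrm{Fix}(g_\nu^p,U',\mathcal C)=\{x_{fp}(\nu)\}$ for $\nu\in[\nu^*,\nu_2]$, $1\le p<k$; $\mathrm{Fix}(g_\nu^k,U',\mathcal C)=\{x_{fp}(\nu),x_{b_1}(\nu),x_{b_2}(\nu)\}$ for $\nu\in[\nu^*,\nu_2]$; and $\#\mathrm{Fix}(g_\nu^k,U',\mathcal C)=3$ for $\nu\in(\nu^*,\nu_2]$; (2) if $k$ is even, then $g_\nu^{k/2}(x_{b_1}(\nu))=x_{b_2}(\nu)$ and $g_\nu^{k/2}(x_{b_2}(\nu))=x_{b_1}(\nu)$ for $\nu\in(\nu^*,\nu_2]$. Setting. Consider a Hamiltonian system $\dot x=J\nabla H(x)$ on $\mathbb R^{2n+2}$, $J$ the standard symplectic matrix, $H\colon\mathbb R^{2n+2}\to\mathbb R$ of class $\mathcal C^4$, reversible with respect to $R$. Let $\Pi\subset\mathbb R^{2n+2}$ be a $\mathcal C^3$-smooth Poincaré section with $\mathrm{Fix}(R)\subset\Pi$ and $\mathcal P\colon\Pi\to\Pi$ the Poincaré map; it is then $R|_\Pi$-reversible (i.e. $R^{-1}\circ\mathcal P\circ R\circ\mathcal P=\mathrm{id}$ on its domain). Near an apparent bifurcation point there are local coordinates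 $(p_0,p,q_0,q)\in\mathbb R\times\mathbb R^n\times\mathbb R\times\mathbb R^n$ in which $\Pi=\{q_0=0\}$ and $\mathrm{Fix}(R)=\{q_0=0,\,q=0\}$. We use coordinates $(p_0,p,q)$ on $\Pi$ and omit $q_0=0$ from the arguments of $\mathcal P$ and $H$. The vector field is transverse to $\Pi$ near the apparent bifurcation point, so that $\mathcal P$ is well defined and smooth. Let $\Pi_h=\{(p_0,p,q)\in\Pi:H(p_0,p,q)=h\}$. Where $\frac{\partial H}{\partial p_0}\neq0$, $\Pi_h$ is locally parametrized as $(p_0(h,p,q),p,q)$ for $h$ in some interval, and $f(h,p,q)=\pi_{(p,q)}\mathcal P(p_0(h,p,q),p,q)$, $f_h=f(h,\cdot)$; thus $f_h$ is $\mathcal P|_{\Pi_h}$ in the coordinates $(p,q)$, and $R$-symmetric means $q=0$. Fix $k>1$ and split $p=(p_1,p_2)$, $q=(q_1,q_2)\in\mathbb R\times\mathbb R^{n-1}$. There is a smooth curve, on an explicit open interval $P_0$, $P_0\ni p_0\mapsto x_{fp}^H(p_0)=(p_0,p_1(p_0),p_2(p_0),0)$, and sets $P_1,P_2$, such that for $i=1,\dots,k-1$: $\mathrm{Fix}(\mathcal P^{2i},P_0\times P_1\times P_2\times\{0\})=\{x_{fp}^H(p_0):p_0\in P_0\}$. (HC2) $P_1$ is a closed interval and $P_2$ a closed set such that $p_1(p_0)\in\mathrm{int}\,P_1$ for $p_0\in P_0$, and there is a smooth function $p_2^H\colon P_0\times P_1\to\mathrm{int}\,P_2$ such that for $(p_0,p_1,p_2)\in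 P_0\times P_1\times P_2$: $\pi_{q_2}(\mathcal P^k(p_0,p_1,p_2,0))=0\iff p_2=p_2^H(p_0,p_1)$. Define $G_k^H(p_0,p_1)=\pi_{q_1}(\mathcal P^k(p_0,p_1,p_2^H(p_0,p_1),0))$, which factorizes as $(p_1-p_1(p_0))g_k^H(p_0,p_1)$ with $g_k^H(p_0,p_1)=\int_0^1\frac{\partial G_k^H}{\partial p_1}(p_0,p_1(p_0)+t(p_1-p_1(p_0)))\,dt$. (HC3) There is a smooth function $P_1\ni p_1\mapsto p_0(p_1)\in P_0$ such that $\{(p_0,p_1)\in P_0\times P_1:g_k^H(p_0,p_1)=0\}=\{(p_0(p_1),p_1):p_1\in P_1\}$. (HC4) $0\notin\frac{\partial^2G_k^H}{\partial p_0\partial p_1}(P_0\times P_1)+\frac{\partial^2G_k^H}{\partial p_1^2}(P_0\times P_1)\,p_1'(P_0)$. (Under these assumptions the two curves intersect at a unique point.) Define $s(p_0,p,q)=(H(p_0,p,q),p,q)$, $x_b^H(p_1)=(p_0(p_1),p_1,p_2^H(p_0(p_1),p_1),0)$, $h_{fp}(p_0)=H(x_{fp}^H(p_0))$ and $h_b(p_1)=H(x_b^H(p_1))$. *)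

(* Defs.v *)
From HB Require Import structures.
From mathcomp Require Import all_boot all_order all_algebra.
From mathcomp Require Import all_classical all_reals all_analysis.
Set Implicit Arguments.
Unset Strict Implicit.
Unset Printing Implicit Defensive.
Import Order.TTheory GRing.Theory Num.Theory.
Import numFieldNormedType.Exports.
Local Open Scope ring_scope.
Local Open Scope classical_set_scope.

Section Regularity.
Context {R : realType} {V W : normedModType R}.

(* f is of class C^r on D; meant for D open and V finite-dimensional, where it
   is enough to control all directional derivatives. *)
Fixpoint Cr (r : nat) (D : set V) (f : V -> W) : Prop :=
  if r is r'.+1 then
    (forall x, D x -> differentiable f x) /\
    (forall v, Cr r' D (fun x => 'D_v f x))
  else forall x, D x -> {for x, continuous f}.

(* f is of class C^r on an arbitrary, possibly closed, set A. *)
Definition smooth_on (r : nat) (A : set V) (f : V -> W) : Prop :=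
  exists D : set V, [/\ open D, A `<=` D & Cr r D f].

End Regularity.

Section PartialMaps.
Context {T : Type}.

(* Partial self-maps are option-valued; piter m g is the m-th iterate, defined
   at x exactly when the m successive images exist. *)
Definition piter (m : nat) (g : T -> option T) (x : T) : option T :=
  iter m (obind g) (Some x).

Definition Fix (g : T -> option T) (U C : set T) : set T :=
  [set x | [/\ U x, g x = Some x & C x]].

End PartialMaps.

Section Tupling.
Context {R : realType} {X : normedModType R}.

Definition family_dom (g : R -> X -> option X) : set (R * X) :=
  [set z | isSome (g z.1 z.2)].

(* g has a period k-tupling bifurcation at the pair z with respect to the
   predicate C; "smooth" is C^r. *)
Definition period_tupling (r k : nat) (g : R -> X -> option X) (C : set X)
    (z : R * X) : Prop :=
  [/\ (0 < k)%N, open (family_dom g), family_dom g z &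
  exists (nu1 nu2 : R) (U : set X) (xfp xb1 xb2 : R -> X),
  [/\ [set` `[nu1, nu2]] `*` U `<=` family_dom g
        /\ ([set` `[nu1, nu2]] `*` U)° z,
      [/\ forall nu, nu1 <= nu <= nu2 -> U° (xfp nu),
          forall nu, z.1 <= nu <= nu2 -> U° (xb1 nu)
        & forall nu, z.1 <= nu <= nu2 -> U° (xb2 nu)],
      [/\ {within `[nu1, nu2], continuous xfp} /\ Cr r `]nu1, nu2[ xfp,
          {within `[z.1, nu2], continuous xb1} /\ Cr r `]z.1, nu2[ xb1,
          {within `[z.1, nu2], continuous xb2} /\ Cr r `]z.1, nu2[ xb2
        & [/\ xb1 z.1 = z.2, xb2 z.1 = z.2 & xfp z.1 = z.2]],
      [/\ forall nu p, nu1 <= nu <= z.1 -> (1 <= p <= k)%N ->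
            Fix (piter p (g nu)) U C = [set xfp nu],
          forall nu p, z.1 <= nu <= nu2 -> (1 <= p < k)%N ->
            Fix (piter p (g nu)) U C = [set xfp nu],
          forall nu, z.1 <= nu <= nu2 ->
            Fix (piter k (g nu)) U C = [set xfp nu; xb1 nu; xb2 nu]
        & forall nu, z.1 < nu <= nu2 -> (Fix (piter k (g nu)) U C #= `I_3)%card]
    & ~~ odd k -> forall nu, z.1 < nu <= nu2 ->
        piter k./2 (g nu) (xb1 nu) = Some (xb2 nu) /\
        piter k./2 (g nu) (xb2 nu) = Some (xb1 nu)]].

End Tupling.

Section Hamiltonian.
Variables (R : realType) (n : nat).

Definition phase := 'cV[R]_(n.+1 + n.+1).

(* R^n, for n > 0, with the splitting x = (x_1, x_2) in R x R^(n-1). *)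
Definition Rn := (R * 'rV[R]_n.-1)%type.

(* (p_0, p, q_0, q) *)
Definition fullcoord := (R * Rn * R * Rn)%type.

(* (p, q) *)
Definition pqcoord := (Rn * Rn)%type.

(* (p_0, (p, q)), with q_0 = 0 omitted *)
Definition seccoord := (R * pqcoord)%type.

Definition emb (x : seccoord) : fullcoord := (x.1, x.2.1, 0, x.2.2).
Definition prj (y : fullcoord) : seccoord := (y.1.1.1, (y.1.1.2, y.2)).

Definition symplectic_mx : 'M[R]_(n.+1 + n.+1) :=
  block_mx 0 1%:M (- 1%:M) 0.

Definition gradient (H : phase -> R) (x : phase) : phase :=
  \col_i 'D_(delta_mx i 0 : phase) H x.

Definition ham_field (H : phase -> R) (x : phase) : phase :=
  symplectic_mx *m gradient H x.

Definition reversible_field (X rho : phase -> phase) : Prop :=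
  forall x, differentiable rho x /\ 'd rho x (X x) = - X (rho x).

Definition Cr_hypersurface (r : nat) (S : set phase) : Prop :=
  forall x, S x -> exists (U : set phase) (a : phase -> R),
    [/\ open U, U x, Cr r U a,
        forall y, U y -> exists v, 'D_v a y != 0
      & forall y, U y -> (S y <-> a y = 0)].

(* Wherever P is defined, it is the first return to S along the flow of X. *)
Definition poincare_map (X : phase -> phase) (S : set phase)
    (P : phase -> option phase) : Prop :=
  forall x y, P x = Some y -> S x /\
    exists (t : R) (u : R -> phase),
      [/\ 0 < t, u 0 = x, u t = y,
          forall s, 0 <= s <= t -> is_derive s 1 u (X (u s))
        & S y /\ forall s, 0 < s < t -> ~ S (u s)].

(* The domain of P is relatively open in S, and P is there the restriction of
   an ambient C^r map. *)
Definition Cr_section_map (r : nat) (S : set phase)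
    (P : phase -> option phase) : Prop :=
  exists (D : set phase) (F : phase -> phase),
    [/\ open D, Cr r D F,
        forall x, isSome (P x) <-> S x /\ D x
      & forall x, S x -> D x -> P x = Some (F x)].

(* rho^-1 o P o rho o P = id on the domain of P *)
Definition reversible_map (rho rhoV : phase -> phase)
    (P : phase -> option phase) : Prop :=
  forall x, isSome (P x) ->
    omap rhoV (obind (fun y => P (rho y)) (P x)) = Some x.

Record hamiltonian_setting (H : phase -> R) (rho rhoV : phase -> phase)
    (S : set phase) (P : phase -> option phase) : Prop := {
  hs_ham : Cr 4 setT H ;
  hs_invl : cancel rho rhoV ;
  hs_invr : cancel rhoV rho ;
  hs_rev : reversible_field (ham_field H) rho ;
  hs_sec : Cr_hypersurface 3 S ;
  hs_fix : [set x | rho x = x] `<=` S ;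
  hs_poincare : poincare_map (ham_field H) S P ;
  hs_smooth : Cr_section_map 3 S P ;
  hs_revP : reversible_map rho rhoV P
}.

(* Local C^3 coordinates (p_0, p, q_0, q), not assumed symplectic, on the open
   set lc_dom, straightening S to q_0 = 0 and Fix(rho) to q_0 = 0, q = 0. *)
Record local_coords (S : set phase) (rho : phase -> phase) := {
  lc_dom : set phase ;
  lc_cod : set fullcoord ;
  lc_map : phase -> fullcoord ;
  lc_inv : fullcoord -> phase ;
  lc_dom_open : open lc_dom ;
  lc_cod_open : open lc_cod ;
  lc_mapP : forall x, lc_dom x -> lc_cod (lc_map x) /\ lc_inv (lc_map x) = x ;
  lc_invP : forall y, lc_cod y -> lc_dom (lc_inv y) /\ lc_map (lc_inv y) = y ;
  lc_map_smooth : Cr 3 lc_dom lc_map ;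
  lc_inv_smooth : Cr 3 lc_cod lc_inv ;
  lc_section : forall x, lc_dom x -> (S x <-> (lc_map x).1.2 = 0) ;
  lc_fix : forall x, lc_dom x ->
    (rho x = x <-> (lc_map x).1.2 = 0 /\ (lc_map x).2 = 0)
}.

Section InCoordinates.
Variables (S : set phase) (rho : phase -> phase) (c : local_coords S rho).
Variables (H : phase -> R) (P : phase -> option phase).

Definition cdom : set seccoord := [set x | lc_cod c (emb x)].

Definition energy (x : seccoord) : R := H (lc_inv c (emb x)).

(* P^m in the coordinates (p_0, p, q): only the two end points of the orbit
   segment have to lie in the chart. *)
Definition Pcoord (m : nat) (x : seccoord) : option seccoord :=
  if `[< cdom x >] then
    obind (fun y => if `[< lc_dom c y >] then Some (prj (lc_map c y)) else None)
          (piter m P (lc_inv c (emb x)))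
  else None.

Definition transverse_near (x : seccoord) : Prop :=
  \forall y \near lc_inv c (emb x),
    S y -> 'D_(ham_field H y) (fun w => (lc_map c w).1.2) y != 0.

Definition smap (x : seccoord) : R * pqcoord := (energy x, x.2).

(* On the part D of the section, the energy levels are the graphs
   {(p_0(h,p,q), p, q) : (h,p,q) in W}. *)
Definition level_param (r : nat) (D : set seccoord) (W : set (R * pqcoord))
    (p0f : R * pqcoord -> R) : Prop :=
  [/\ open D, D `<=` cdom, open W /\ Cr r W p0f,
      forall w, W w -> D (p0f w, w.2) /\ energy (p0f w, w.2) = w.1
    & forall x, D x -> W (smap x) /\ p0f (smap x) = x.1].

(* f_h^m, i.e. P^m restricted to the energy level h, in the coordinates (p, q);
   levelmap W p0f 1 h is f_h itself. Since P may move a point x to a P x that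
   is not covered by the parametrization around x, taking P^m in the ambient
   space makes sense more often than iterating levelmap W p0f 1 h literally;
   the two agree when the intermediate points are covered. *)
Definition levelmap (W : set (R * pqcoord)) (p0f : R * pqcoord -> R)
    (m : nat) (h : R) (y : pqcoord) : option pqcoord :=
  if `[< W (h, y) >] then omap snd (Pcoord m (p0f (h, y), y)) else None.

(* R-symmetry in the coordinates (p, q), see lc_fix. *)
Definition sym_pred : set pqcoord := [set y | y.2 = 0].

Section Bifurcation.
Variables (r k : nat) (P0 P1 : set R) (P2 : set 'rV[R]_n.-1).

(* (p_0, p_1, p_2, 0) *)
Definition sympt (p0 p1 : R) (p2 : 'rV[R]_n.-1) : seccoord :=
  (p0, ((p1, p2), 0)).

Definition symbox : set seccoord :=
  [set x | [/\ P0 x.1, P1 x.2.1.1, P2 x.2.1.2 & x.2.2 = 0]].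

Definition xfpH (p1c : R -> R) (p2c : R -> 'rV[R]_n.-1) (p0 : R) : seccoord :=
  sympt p0 (p1c p0) (p2c p0).

Definition fixed_curve (p1c : R -> R) (p2c : R -> 'rV[R]_n.-1) : Prop :=
  [/\ is_interval P0, open P0, smooth_on r P0 p1c, smooth_on r P0 p2c
    & forall i, (1 <= i <= k.-1)%N ->
        Fix (Pcoord (2 * i)) symbox setT = xfpH p1c p2c @` P0].

Definition HC2 (p1c : R -> R) (p2H : R * R -> 'rV[R]_n.-1) : Prop :=
  [/\ [/\ is_interval P1, closed P1 & closed P2],
      forall p0, P0 p0 -> P1° (p1c p0),
      smooth_on r (P0 `*` P1) p2H,
      forall z, (P0 `*` P1) z -> P2° (p2H z)
    & forall p0 p1 p2, P0 p0 -> P1 p1 -> P2 p2 ->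
        exists2 y, Pcoord k (sympt p0 p1 p2) = Some y
                 & (y.2.2.2 = 0 <-> p2 = p2H (p0, p1))].

(* The value where P^k is undefined is irrelevant: under HC2, P^k is defined
   around the points considered. *)
Definition GkH (p2H : R * R -> 'rV[R]_n.-1) (p0 p1 : R) : R :=
  if Pcoord k (sympt p0 p1 (p2H (p0, p1))) is Some y then y.2.2.1 else 0.

Definition partial0 (F : R -> R -> R) (a b : R) : R := derive1 (F ^~ b) a.
Definition partial1 (F : R -> R -> R) (a b : R) : R := derive1 (F a) b.

Definition gkH (p1c : R -> R) (p2H : R * R -> 'rV[R]_n.-1) (p0 p1 : R) : R :=
  \int[lebesgue_measure]_(t in `[0, 1])
     partial1 (GkH p2H) p0 (p1c p0 + t * (p1 - p1c p0)).

Definition HC3 (p1c : R -> R) (p2H : R * R -> 'rV[R]_n.-1) (p0b : R -> R) :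
    Prop :=
  [/\ smooth_on r P1 p0b, forall p1, P1 p1 -> P0 (p0b p1)
    & [set z | (P0 `*` P1) z /\ gkH p1c p2H z.1 z.2 = 0]
      = [set (p0b p1, p1) | p1 in P1]].

Definition HC4 (p1c : R -> R) (p2H : R * R -> 'rV[R]_n.-1) : Prop :=
  let G := GkH p2H in
  let A := (fun z => partial0 (partial1 G) z.1 z.2) @` (P0 `*` P1) in
  let B := (fun z => partial1 (partial1 G) z.1 z.2) @` (P0 `*` P1) in
  let C := p1c^`() @` P0 in
  ~ [set u + v | u in A & v in [set b * e | b in B & e in C]] 0.

Definition xbH (p2H : R * R -> 'rV[R]_n.-1) (p0b : R -> R) (p1 : R) : seccoord :=
  sympt (p0b p1) p1 (p2H (p0b p1, p1)).

Definition hfp (p1c : R -> R) (p2c : R -> 'rV[R]_n.-1) (p0 : R) : R :=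
  energy (xfpH p1c p2c p0).

Definition hb (p2H : R * R -> 'rV[R]_n.-1) (p0b : R -> R) (p1 : R) : R :=
  energy (xbH p2H p0b p1).

End Bifurcation.
End InCoordinates.
End Hamiltonian.

(* Main.v *)
Require Import Defs.
From HB Require Import structures.
From mathcomp Require Import all_boot all_order all_algebra.
From mathcomp Require Import all_classical all_reals all_analysis.
From mathcomp Require Import lra zify.
Import Order.TTheory GRing.Theory Num.Theory.
Import numFieldNormedType.Exports.
Local Open Scope ring_scope.
Local Open Scope classical_set_scope.

(** Why a pitchfork in the energy appears.

    Reversibility turns the search for symmetric periodic points into the
    search for zeros.  If x is symmetric, then P^(2k) x = x exactly when P^k x
    is symmetric as well, that is when its q-part vanishes
    ([Pcoord_sym_fixed]).  Condition (HC2) solves the equation for q_2, and the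
    one left for q_1 is G = 0 with G = [GkH].  Since G vanishes on the known
    curve p_1 = p_1(p_0), Taylor's formula with integral remainder
    ([increment_integral]) splits off the factor p_1 - p_1(p_0), and (HC3)
    describes the zeros of the other factor.  Hence, in the box
    P_0 x P_1 x P_2, the symmetric fixed points of P^(2k) are the points of two
    curves, x_fp and x_b ([box_fixed]), while those of P^(2i) with 0 < i < k
    form x_fp alone.  By (HC4) the factor g_k has a nonzero derivative along x_fp,
    so by Rolle's theorem the curves meet only at x^*
    ([intersection_unique]).

    The period k-tupling occurs when both curves are read as functions of the
    energy h.  As h_fp' > 0 at p_0^*, the curve x_fp can be parametrized by h
    ([regular_branch]).  On x_b the energy has a critical point at p_1^*
    ([hb_critical]): P^k preserves the energy and maps each point of x_b
    near x^*, other than x^*, to a different point of x_b, since k is even,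
    0 < k/2 < k, and a fixed point of P^k would lie on x_fp.  So h_b takes
    equal values at distinct points arbitrarily close to p_1^*, and Rolle's
    theorem gives h_b' = 0 there.  As h_b'' > 0, the level h_b = h has no point
    near p_1^* for h < h^*, the point p_1^* for h = h^* and one point on either
    side of p_1^* for h > h^* ([fold_branches]).  These are the two new
    branches; P^k exchanges them, because they are the only points of x_b near
    x^* with that energy.

    What remains is to relate f_h^2 and its iterates to P^2 and its iterates.
    As P^2 fixes x^*, the first k iterates under P^2 of a point near x^* stay
    near x^*, hence in the part of the section covered by the energy levels;
    there, fixed points of the p-th iterate of f_h^2 and of P^(2p) correspond
    to each other ([levelmap_chart]).

    All regularity claims reduce to closure properties of C^r maps between
    finite-dimensional spaces, C^r being defined by iterated directional
    derivatives; the main one is the chain rule [Cr_comp]. *)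

Set Implicit Arguments.
Unset Strict Implicit.
Unset Printing Implicit Defensive.

(** * Differentiable functions of class C^r *)

Section Differentiability.
Context {R : realType}.
Implicit Types U V W : normedModType R.

(** Differentiability is local: functions that agree near x differ by one that
    vanishes near x, whose remainder is trivially small. *)
Lemma near_eq_differentiable V W (f g : V -> W) x :
  {near x, f =1 g} -> differentiable f x -> differentiable g x.
Proof.
move=> fg df.
pose e y := g y - f y.
suff de : differentiable e x.
  have -> : g = f + e by apply/funext => y; rewrite /e fctE addrC subrK.
  exact: differentiableD.
pose z : {linear V -> W} := \0.
have z0 : z = (fun=> 0) :> (V -> W) by [].
have zc : continuous z by rewrite z0 => y; exact: cvg_cst.
have ez : e \o shift x = cst (e x) + z +o_ 0 id.
  apply/eqaddoP => eps eps0.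
  have : \forall y \near x, e y = 0.
    by near=> y; rewrite /e (near fg y) ?subrr//; near: y.
  rewrite (near_shift 0 x) => e0; near=> y.
  have ey : e (y + x) = 0 by rewrite -[x]subr0; near: y; exact: e0.
  rewrite !fctE z0 /= ey /e (nbhs_singleton fg) subrr addr0 subr0.
  by rewrite normr0 mulr_ge0// ltW.
apply/diff_locallyP; rewrite (diff_unique zc ez); split => //.
Unshelve. all: by end_near. Qed.

(** A finite family of vectors with continuous coordinate forms: all that the
    chain rule for directional derivatives uses of finite dimension. *)
Definition finite_coords V : Prop :=
  exists (I : finType) (e : I -> V) (phi : I -> {linear V -> R^o}),
    (forall i, continuous (phi i)) /\ forall v, v = \sum_i phi i v *: e i.

End Differentiability.

Section Cr_calculus.
Context {R : realType}.
Implicit Types U V W : normedModType R.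

Lemma Cr_ext V W r (D : set V) (f g : V -> W) :
  open D -> (forall x, D x -> f x = g x) -> Cr r D f -> Cr r D g.
Proof.
move=> oD; elim: r f g => [|r IH] f g fg /=.
  move=> cf x Dx; have := cf x Dx; rewrite /prop_for /continuous_at -fg//.
  apply: cvg_trans; apply: near_eq_cvg; near=> y; apply: fg; near: y.
  exact: open_nbhs_nbhs.
move=> [df dDf]; have nfg x : D x -> {near x, f =1 g}.
  by move=> Dx; near=> y; apply: fg; near: y; exact: open_nbhs_nbhs.
split=> [x Dx|v]; first exact: near_eq_differentiable (nfg x Dx) (df x Dx).
apply: IH (dDf v) => x Dx; exact: near_eq_derive (nfg x Dx).
Unshelve. all: by end_near. Qed.

Lemma Cr_sub V W r (D E : set V) (f : V -> W) :
  D `<=` E -> Cr r E f -> Cr r D f.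
Proof.
move=> DE; elim: r f => [|r IH] f /=; first by move=> cf x /DE /cf.
by move=> [df dDf]; split=> [x /DE /df//|v]; apply: IH.
Qed.

Lemma Cr_continuous V W r (D : set V) (f : V -> W) x :
  Cr r D f -> D x -> {for x, continuous f}.
Proof.
case: r => [|r] /=; first by move=> cf /cf.
by move=> [df _] Dx; apply: differentiable_continuous; apply: df.
Qed.

Lemma CrS V W r (D : set V) (f : V -> W) : Cr r.+1 D f -> Cr r D f.
Proof.
elim: r f => [|r IH] f; first by move=> df x Dx; exact: Cr_continuous df Dx.
by move=> [df dDf]; split => // v; apply: IH.
Qed.

Lemma Cr_leq V W m r (D : set V) (f : V -> W) :
  (m <= r)%N -> Cr r D f -> Cr m D f.
Proof.
elim: r m f => [|r IH] m f; first by rewrite leqn0 => /eqP ->.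
by rewrite leq_eqVlt => /predU1P[->//|mr /CrS]; apply: IH.
Qed.

Lemma open_preimage_on V W r (A : set V) (B : set W) (f : V -> W) :
  open A -> Cr r A f -> open B -> open (A `&` f @^-1` B).
Proof.
move=> oA cf oB; rewrite openE => x [Ax Bfx]; apply: filterI.
  exact: open_nbhs_nbhs.
by apply: (Cr_continuous cf Ax); exact: open_nbhs_nbhs.
Qed.

Lemma Cr_differentiable V W r (D : set V) (f : V -> W) x :
  (0 < r)%N -> Cr r D f -> D x -> differentiable f x.
Proof. by case: r => // r _ [df _] /df. Qed.

Lemma Cr_cst V W r (D : set V) (w : W) : Cr r D (cst w).
Proof.
elim: r w => [|r IH] w /=; first by move=> x _; exact: cvg_cst.
split=> // v; rewrite (_ : (fun x => _) = cst 0); first exact: IH.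
by apply/funext => x; rewrite derive_cst.
Qed.

Lemma Cr_add V W r (D : set V) (f g : V -> W) :
  open D -> Cr r D f -> Cr r D g -> Cr r D (f + g).
Proof.
move=> oD; elim: r f g => [|r IH] f g /=.
  by move=> cf cg x Dx; apply: continuousD; [exact: cf|exact: cg].
move=> [df dDf] [dg dDg]; split=> [x Dx|v].
  by apply: differentiableD; [exact: df|exact: dg].
apply: (@Cr_ext _ _ _ _ ((fun x => 'D_v f x) + (fun x => 'D_v g x))) => //.
  move=> x Dx; rewrite deriveD//; apply: diff_derivable; [exact: df|exact: dg].
exact: IH.
Qed.

Lemma Cr_sum V W r (D : set V) (I : finType) (f : I -> V -> W) :
  open D -> (forall i, Cr r D (f i)) -> Cr r D (fun x => \sum_i f i x).
Proof.
move=> oD cf; have -> : (fun x => \sum_i f i x) = \sum_i f i.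
  by apply/funext => x; rewrite fct_sumE.
apply: big_ind => //; first exact: Cr_cst.
by move=> g h; apply: Cr_add.
Qed.

(** Scaling is a continuous bilinear map, so the product rule is the chain rule
    applied to it. *)
Lemma diff_scale V W (a : V -> R) (f : V -> W) x :
  differentiable a x -> differentiable f x ->
  differentiable (fun y => a y *: f y) x /\
  forall v, 'D_v (fun y => a y *: f y) x = 'D_v a x *: f x + a x *: 'D_v f x.
Proof.
move=> da df; pose B (s : R^o) (w : W) := s *: w.
have lB2 u' : linear (B u').
  by move=> k u v; rewrite /B scalerDr !scalerA mulrC.
have lB1 u : linear (B^~ u).
  by move=> k u' v'; rewrite /B scalerDl scalerA.
have bB : bilinear_for (GRing.Scale.Law.clone _ _ *:%R _)
   (GRing.Scale.Law.clone _ _ *:%R _) B by split.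
pose BM := bilinear_isBilinear.Build R R^o W W _ _ B bB.
pose BL : {bilinear R^o -> W -> W} := HB.pack B BM.
have cB : continuous (fun p : R^o * W => BL p.1 p.2).
  by move=> p; apply: (@continuousZ _ _ _ fst snd);
    [exact: cvg_fst|exact: cvg_snd].
have dp : differentiable (fun y => (a y : R^o, f y)) x.
  exact: differentiable_pair.
have dBp := @differentiable_bilin _ R^o W W BL (a x, f x) cB.
have dc := differentiable_comp dp dBp; split=> // v.
rewrite (deriveE _ dc) (diff_comp dp dBp) /=.
rewrite (@diff_bilin _ R^o W W BL (a x, f x) cB) /= (@diff_pair _ _ R^o)//=.
by rewrite -!deriveE// addrC.
Qed.

Lemma Cr_scale V W r (D : set V) (a : V -> R) (f : V -> W) :
  open D -> Cr r D a -> Cr r D f -> Cr r D (fun x => a x *: f x).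
Proof.
move=> oD; elim: r a f => [|r IH] a f.
  by move=> ca cf x Dx; apply: continuousZ; [exact: ca|exact: cf].
move=> Ca Cf; have [[da dDa] [df dDf]] := (Ca, Cf).
have ds x Dx := @diff_scale _ _ _ _ x (da x Dx) (df x Dx).
split=> [x /ds[]//|v].
apply: (@Cr_ext _ _ _ _
  ((fun x => 'D_v a x *: f x) + (fun x => a x *: 'D_v f x))) => //.
  by move=> x /ds[_ ->].
have [Ca' Cf'] := (CrS Ca, CrS Cf).
by apply: Cr_add => //; apply: IH => //; [exact: dDa|exact: dDf].
Qed.

Lemma Cr_mul V r (D : set V) (a b : V -> R) :
  open D -> Cr r D a -> Cr r D b -> Cr r D (fun x => a x * b x).
Proof. by move=> oD Ca Cb; exact: (@Cr_scale V R^o r D a b oD Ca Cb). Qed.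

Lemma diff_linear V W (f : V -> W) x : linear f -> continuous f ->
  differentiable f x /\ 'd f x = f :> (V -> W).
Proof.
move=> lf cf; pose fM := GRing.isLinear.Build _ _ _ _ _ lf.
pose fL : {linear V -> W} := HB.pack f fM.
split; first exact: (@linear_differentiable _ _ _ fL x cf).
exact: (@diff_lin _ _ _ fL x cf).
Qed.

Lemma Cr_comp_linear U V W r (D : set U) (g : U -> V) (f : V -> W) :
  open D -> linear f -> continuous f -> Cr r D g -> Cr r D (f \o g).
Proof.
move=> oD lf cf; elim: r g => [|r IH] g /=.
  by move=> cg x Dx; apply: continuous_comp; [exact: cg|exact: cf].
have dl x := diff_linear x lf cf.
move=> [dg dDg]; split=> [x Dx|v].
  by apply: differentiable_comp; [exact: dg|case: (dl (g x))].
apply: (@Cr_ext _ _ _ _ (f \o (fun x => 'D_v g x))) => //; last exact: IH.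
move=> x Dx /=; have [d1 d2] := dl (g x).
have dc : differentiable (f \o g) x.
  by apply: differentiable_comp d1; exact: dg.
rewrite (deriveE _ dc) diff_comp//=; last exact: dg.
by rewrite d2 deriveE//; exact: dg.
Qed.

(** The chain rule gives 'D_v (f o g) = 'd f ('D_v g), which is not yet an
    expression in directional derivatives of f along fixed vectors.  Expanding
    'D_v g in coordinates makes it a sum of products of C^r functions, which is
    where finite dimension is used. *)
Lemma Cr_comp U V W r (D : set U) (E : set V) (g : U -> V) (f : V -> W) :
  finite_coords V -> open D -> (forall x, D x -> E (g x)) ->
  Cr r D g -> Cr r E f -> Cr r D (f \o g).
Proof.
move=> [I [e [phi [cphi eE]]]] oD gDE; elim: r f => [|r IH] f.
  move=> cg cf x Dx; apply: continuous_comp; [exact: cg|].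
  exact/cf/gDE.
move=> Cg [df dDf]; have [dg dDg] := Cg.
split=> [x Dx|v].
  by apply: differentiable_comp; [exact: dg|apply/df/gDE].
apply: (@Cr_ext _ _ _ _
  (fun x => \sum_i (phi i ('D_v g x) : R) *: ('D_(e i) f (g x)))) => //.
  move=> x Dx; have dgx := dg x Dx; have dfx := df _ (gDE x Dx).
  have dc : differentiable (f \o g) x by exact: differentiable_comp.
  rewrite (deriveE v dc) (diff_comp dgx dfx) /= -(deriveE v dgx).
  rewrite [in RHS](eE ('D_v g x)) linear_sum; apply: eq_bigr => i _.
  by rewrite linearZ (deriveE _ dfx).
apply: Cr_sum => // i; apply: Cr_scale => //.
  exact: (@Cr_comp_linear U V R^o r D (fun x => 'D_v g x) (phi i) oD
    (linearP (phi i)) (cphi i) (dDg v)).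
exact: (IH (fun y => 'D_(e i) f y) (CrS Cg) (dDf (e i))).
Qed.

Lemma Cr_pair U V W r (D : set U) (f : U -> V) (g : U -> W) :
  open D -> Cr r D f -> Cr r D g -> Cr r D (fun x => (f x, g x)).
Proof.
move=> oD Cf Cg.
pose l (v : V) : V * W := (v, 0); pose m (w : W) : V * W := (0, w).
have -> : (fun x => (f x, g x)) = (l \o f) + (m \o g).
  by apply/funext => x; congr pair; rewrite /= ?addr0 ?add0r.
apply: Cr_add => //; apply: Cr_comp_linear => //.
- by move=> k u v; congr pair; rewrite /= scaler0 addr0.
- by move=> x; apply: cvg_pair; [exact: cvg_id|exact: cvg_cst].
- by move=> k u v; congr pair; rewrite /= scaler0 addr0.
- by move=> x; apply: cvg_pair; [exact: cvg_cst|exact: cvg_id].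
Qed.

Lemma Cr_id V r (D : set V) : Cr r D id.
Proof.
case: r => [|r]; first by move=> x _; exact: cvg_id.
split=> [//|v]; rewrite (_ : (fun x => _) = cst v); first exact: Cr_cst.
by apply/funext => x; rewrite derive_id.
Qed.

Lemma Cr_fst U V W r (D : set U) (f : U -> V * W) :
  open D -> Cr r D f -> Cr r D (fun x => (f x).1).
Proof.
move=> oD; apply: (Cr_comp_linear (f := fst)) => // x; exact: cvg_fst.
Qed.

Lemma Cr_snd U V W r (D : set U) (f : U -> V * W) :
  open D -> Cr r D f -> Cr r D (fun x => (f x).2).
Proof.
move=> oD; apply: (Cr_comp_linear (f := snd)) => // x; exact: cvg_snd.
Qed.

Lemma Cr_inv V r (D : set V) (f : V -> R) : open D ->
  (forall x, D x -> f x != 0) -> Cr r D f -> Cr r D (fun x => (f x)^-1).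
Proof.
move=> oD f0; elim: r f f0 => [|r IH] f f0.
  by move=> cf x Dx; apply: continuousV; [exact: f0|exact: cf].
move=> Cf; have [df dDf] := Cf.
split=> [x Dx|v]; first by apply: differentiableV; [exact: df|exact: f0].
apply: (@Cr_ext _ _ _ _
   (fun x => ((-1 * (f x)^-1 : R) * (f x)^-1) *: 'D_v f x)) => //.
  move=> x Dx; rewrite deriveV; [|exact: f0|exact/diff_derivable/df].
  by rewrite mulN1r mulNr -invfM -expr2.
have If := IH f f0 (CrS Cf).
apply: Cr_scale => //; last exact: dDf.
by apply: Cr_mul => //; apply: Cr_mul => //; exact: Cr_cst.
Qed.

Lemma finite_coords_R : finite_coords (R : normedModType R).
Proof.
exists unit, (fun=> 1), (fun=> idfun); split=> [_ x|v]; first exact: cvg_id.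
by rewrite big_const cardE enumT unlock /= addr0 [RHS]mulr1.
Qed.

Lemma finite_coords_mx m n : finite_coords ('M[R]_(m, n) : normedModType R).
Proof.
have lin i j : linear (fun M : 'M[R]_(m, n) => M i j : R^o).
  by move=> k u v; rewrite !mxE.
pose L i j : {linear 'M[R]_(m, n) -> R^o} :=
  HB.pack (fun M : 'M[R]_(m, n) => M i j : R^o)
    (GRing.isLinear.Build _ _ _ _ _ (lin i j)).
exists ('I_m * 'I_n)%type, (fun ij => delta_mx ij.1 ij.2), (fun ij => L ij.1 ij.2).
split=> [[i j]|M]; first exact: coord_continuous.
by rewrite {1}[M]matrix_sum_delta pair_bigA.
Qed.

Lemma finite_coords_prod V W :
  finite_coords V -> finite_coords W -> finite_coords (V * W)%type.
Proof.
move=> [I [e [p [cp eE]]]] [J [e' [q [cq eE']]]].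
have lin1 i : linear (fun x : V * W => p i x.1) by move=> k u v; rewrite linearP.
have lin2 i : linear (fun x : V * W => q i x.2) by move=> k u v; rewrite linearP.
pose L1 i : {linear (V * W)%type -> R^o} := HB.pack (fun x : V * W => p i x.1)
  (GRing.isLinear.Build _ _ _ _ _ (lin1 i)).
pose L2 i : {linear (V * W)%type -> R^o} := HB.pack (fun x : V * W => q i x.2)
  (GRing.isLinear.Build _ _ _ _ _ (lin2 i)).
exists (I + J)%type, (fun s => match s with inl i => (e i, 0) | inr j => (0, e' j) end),
  (fun s => match s with inl i => L1 i | inr j => L2 j end); split.
  move=> [i|j] x /=; apply: continuous_comp.
  - exact: cvg_fst.
  - exact: cp.
  - exact: cvg_snd.
  - exact: cq.
move=> [v w]; rewrite big_sumType /=.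
have -> : \sum_i p i v *: (e i, 0 : W) = (v, 0).
  rewrite [in RHS](eE v); apply: (big_ind2 (fun x y => x = (y, 0))) => //.
    by move=> _ a _ b -> ->; congr pair; rewrite /= addr0.
  by move=> i _; congr pair; rewrite /= scaler0.
have -> : \sum_i q i w *: (0 : V, e' i) = (0, w).
  rewrite [in RHS](eE' w); apply: (big_ind2 (fun x y => x = (0, y))) => //.
    by move=> _ a _ b -> ->; congr pair; rewrite /= addr0.
  by move=> i _; congr pair; rewrite /= scaler0.
by congr pair; rewrite /= ?addr0 ?add0r.
Qed.

End Cr_calculus.

(** * Inverse functions of one variable *)

Section OneVariable.
Context {R : realType}.
Implicit Types (a b : R -> R) (O : set R).

Lemma Cr_derive (V W : normedModType R) r (D : set V) (f : V -> W) v :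
  Cr r.+1 D f -> Cr r D (fun x => 'D_v f x).
Proof. by case=> _; apply. Qed.

Lemma derive_line (W : normedModType R) (f : R -> W) t v :
  differentiable f t -> 'D_v f t = v *: 'D_1 f t.
Proof.
by move=> df; rewrite !deriveE// -linearZ; congr ('d _ _ _); rewrite [RHS]mulr1.
Qed.

(** Only the sign of the derivative in the interior is used, so that the lemma
    also applies on an interval that ends at a critical point. *)
Lemma strictly_increasing_on r O a t0 t1 : (0 < r)%N -> Cr r O a ->
  `[t0, t1] `<=` O -> {in `]t0, t1[%R, forall t, 0 < 'D_1 a t} ->
  forall s t, t0 <= s -> s < t -> t <= t1 -> a s < a t.
Proof.
move=> r0 Ca sO a0 s t t0s st tt1.
have da x : x \in `[t0, t1]%R -> differentiable a x.
  by move=> xt; apply: Cr_differentiable r0 Ca _; exact: sO.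
have sub x : x \in `]t0, t1[%R -> x \in `[t0, t1]%R by exact: subset_itv_oo_cc.
have ct : {within `[t0, t1], continuous a}.
  apply: derivable_within_continuous => x xt.
  exact/diff_derivable/da.
apply: (gtr0_derive1_lt_cc _ _ ct) => //.
- by move=> x /sub xt; exact/diff_derivable/da.
- by move=> x xt; rewrite derive1E; exact: a0.
- by rewrite in_itv/= t0s (le_trans (ltW st)).
- by rewrite in_itv/= tt1 (le_trans t0s (ltW st)).
Qed.

(** The derivative may vanish at the endpoints: the inverse is still continuous
    up to them, but C^r only inside.  Regularity inside follows by induction from
    b' = 1 / (a' o b). *)
Lemma inverse_branch r O a t0 t1 : (0 < r)%N -> t0 < t1 -> open O -> Cr r O a ->
  `[t0, t1] `<=` O -> {in `]t0, t1[%R, forall t, 0 < 'D_1 a t} ->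
  exists b, [/\ forall h, a t0 <= h <= a t1 -> t0 <= b h <= t1 /\ a (b h) = h,
    forall t, t0 <= t <= t1 -> b (a t) = t,
    {within `[a t0, a t1], continuous b} & Cr r `]a t0, a t1[ b].
Proof.
move=> r0 t01 oO Ca sO a0; have le01 := ltW t01.
have inc := strictly_increasing_on r0 Ca sO a0.
have da x : x \in `[t0, t1]%R -> differentiable a x.
  by move=> xt; apply: Cr_differentiable r0 Ca _; exact: sO.
have ct : {within `[t0, t1], continuous a}.
  apply: derivable_within_continuous => x xt; exact/diff_derivable/da.
have inj s t : t0 <= s <= t1 -> t0 <= t <= t1 -> a s = a t -> s = t.
  move=> /andP[s0 s1] /andP[tt0 tt1] ast; apply/eqP; rewrite eq_le !leNgt.
  apply/andP; split; apply/negP => lt.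
    by have := inc _ _ tt0 lt s1; rewrite ast ltxx.
  by have := inc _ _ s0 lt tt1; rewrite ast ltxx.
pose b h := xget t0 [set t | t0 <= t <= t1 /\ a t = h].
have surj h : a t0 <= h <= a t1 -> t0 <= b h <= t1 /\ a (b h) = h.
  move=> hh; have [t tt ath] : exists2 t, t \in `[t0, t1]%R & a t = h.
    apply: IVT => //; rewrite (min_idPl _) ?(max_idPr _)//;
      by rewrite ltW ?inc ?lexx.
  have tP : [set t | t0 <= t <= t1 /\ a t = h] t.
    by split => //; move: tt; rewrite in_itv.
  by case: (xgetPex t0 (ex_intro _ t tP)).
have can t : t0 <= t <= t1 -> b (a t) = t.
  move=> /andP[tt0 tt1].
  have aat : a t0 <= a t <= a t1.
    apply/andP; split.
      by move: tt0; rewrite le_eqVlt => /predU1P[->//|?]; rewrite ltW ?inc.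
    by move: tt1; rewrite le_eqVlt => /predU1P[->//|?]; rewrite ltW ?inc.
  by have [bt abt] := surj _ aat; apply: inj => //; rewrite tt0 tt1.
have cb : {within `[a t0, a t1], continuous b}.
  apply: (segment_can_le_continuous le01 ct) => t; rewrite in_itv/=; exact: can.
have binn h : h \in `]a t0, a t1[%R -> b h \in `]t0, t1[%R.
  rewrite in_itv/= => /andP[h0 h1].
  have /surj[/andP[b0 b1] abh] : a t0 <= h <= a t1 by rewrite !ltW.
  rewrite in_itv/= !lt_neqAle b0 b1 !andbT; apply/andP; split; apply/negP => /eqP e.
    by move: h0; rewrite -abh -e ltxx.
  by move: h1; rewrite -abh e ltxx.
have db h : h \in `]a t0, a t1[%R -> is_derive h 1 b ('D_1 a (b h))^-1.
  move=> hh; have bh := binn h hh.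
  have /surj[_ abh] : a t0 <= h <= a t1.
    by move: hh; rewrite in_itv/= => /andP[? ?]; rewrite !ltW.
  rewrite -{1}abh.
  have no : \forall x \near b h, x \in `]t0, t1[%R by exact: near_in_itvoo.
  apply: is_derive_inverse.
  - near=> x; apply: can.
    have : x \in `]t0, t1[%R by near: x.
    by rewrite in_itv/= => /andP[? ?]; rewrite !ltW.
  - near=> x; apply/differentiable_continuous/da/subset_itv_oo_cc.
    by near: x.
  - by apply/derivableP/diff_derivable/da/subset_itv_oo_cc.
  - by rewrite gt_eqF// a0.
exists b; split=> //.
have oI : open (`]a t0, a t1[ : set R) by exact: interval_open.
suff : forall m, (m <= r)%N -> Cr m `]a t0, a t1[ b by apply.
elim=> [_|m IH mr] /=.
  by move=> h /db [dbh _]; apply/differentiable_continuous/derivable1_diffP.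
have db' h : h \in `]a t0, a t1[%R -> differentiable b h.
  by move=> /db[dbh _]; exact/derivable1_diffP.
split=> [h|v]; first exact: db'.
apply: (@Cr_ext _ _ _ _ _ (fun h => v * ('D_1 a (b h))^-1)) => //.
  move=> h hh; rewrite (derive_line _ (db' h hh)); congr (_ * _).
  by have [_ ->] := db h hh.
apply: Cr_mul => //; first exact: Cr_cst.
apply: Cr_inv => //.
  by move=> h hh; rewrite gt_eqF// a0// binn.
apply: (@Cr_comp _ _ _ _ _ _ O b (fun t => 'D_1 a t)) => //.
- exact: finite_coords_R.
- by move=> h hh; apply/sO/subset_itv_oo_cc/binn.
- by apply: IH; exact: ltnW.
- by apply: Cr_derive; apply: Cr_leq Ca.
Unshelve. all: by end_near. Qed.

Lemma derive_gt0_near r O a t : (0 < r)%N -> open O -> Cr r O a -> O t ->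
  0 < 'D_1 a t ->
  exists2 e, 0 < e & `[t - e, t + e] `<=` [set s | O s /\ 0 < 'D_1 a s].
Proof.
case: r => // r _ oO Cra Ot a0; have Ca := @Cr_derive R R r O a (1 : R) Cra.
have ap : \forall s \near t, 0 < 'D_1 a s.
  exact: cvgr_gt (Cr_continuous Ca Ot) _ a0.
have n1 : \forall s \near t, O s /\ 0 < 'D_1 a s.
  near=> s; split; first by near: s; exact: open_nbhs_nbhs.
  by near: s.
have [e /= e0 eO] := n1.
exists (e / 2); first by rewrite divr_gt0.
move=> s /=; rewrite in_itv/= => st; apply: eO => /=.
by rewrite distrC ltr_distlC; lra.
Unshelve. all: by end_near. Qed.

(** A nondegenerate critical point: a' is strictly increasing near t and
    vanishes at t. *)
Lemma derive_sign_near r O a t : (1 < r)%N -> open O -> Cr r O a -> O t ->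
  'D_1 a t = 0 -> 0 < 'D_1 (fun s => 'D_1 a s) t ->
  exists e, [/\ 0 < e, `[t - e, t + e] `<=` O,
    forall s, t < s <= t + e -> 0 < 'D_1 a s &
    forall s, t - e <= s < t -> 'D_1 a s < 0].
Proof.
case: r => // r r0 oO Cra Ot a0 aa0.
have Ca := @Cr_derive R R r O a (1 : R) Cra.
have [e e0 eO] := derive_gt0_near r0 oO Ca Ot aa0.
have inc := @strictly_increasing_on r O (fun s => 'D_1 a s) (t - e) (t + e) r0 Ca.
have {}inc s s' : t - e <= s -> s < s' -> s' <= t + e -> 'D_1 a s < 'D_1 a s'.
  apply: inc => [u /eO[]//|u /subset_itv_oo_cc/eO[]//].
exists e; split => // [s /eO[]//|s /andP[ts st]|s /andP[ts st]].
  by rewrite -a0; apply: inc => //; rewrite gerBl ltW.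
by rewrite -a0; apply: inc => //; rewrite lerDl ltW.
Qed.

End OneVariable.

Section Branches.
Context {R : realType}.
Implicit Types (a b : R -> R) (O : set R).

(** The local inverse at a regular point; hmin and hmax are the values at the ends
    of an interval where the derivative stays positive. *)
Lemma regular_branch r O a t : (0 < r)%N -> open O -> Cr r O a -> O t ->
  0 < 'D_1 a t -> exists e hmin hmax b,
  [/\ 0 < e /\ hmin < a t < hmax, b (a t) = t,
    forall h, hmin <= h <= hmax -> O (b h) /\ a (b h) = h,
    forall s, t - e <= s <= t + e -> hmin <= a s <= hmax -> b (a s) = s &
    Cr r `]hmin, hmax[ b].
Proof.
move=> r0 oO Ca Ot a0; have [e e0 eO] := derive_gt0_near r0 oO Ca Ot a0.
have sO : `[t - e, t + e] `<=` O by move=> s /eO[].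
have a0' : {in `]t - e, t + e[%R, forall s, 0 < 'D_1 a s}.
  by move=> s /subset_itv_oo_cc/eO[].
have lt : t - e < t + e by lra.
have [b [bP bK _ Cb]] := inverse_branch r0 lt oO Ca sO a0'.
have inc := strictly_increasing_on r0 Ca sO a0'.
exists e, (a (t - e)), (a (t + e)), b; split=> //.
- by split=> //; apply/andP; split; apply: inc => //; lra.
- by apply: bK; lra.
- move=> h /bP[bh abh]; split=> //; apply: sO; exact: bh.
- by move=> s st _; apply: bK.
Qed.

Lemma derive_reflect a s : derivable a (- s) 1 ->
  'D_1 (fun s => a (- s)) s = - 'D_1 a (- s).
Proof.
move=> da; have dN : derivable (-%R : R -> R) s 1 by exact: derivable_opp.
have := derive1_comp dN da; rewrite !derive1E => ->.
by have [_ ->] := @is_deriveNid R R s 1; rewrite mulrN1.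
Qed.

(** The function is strictly decreasing before a nondegenerate minimum t and
    strictly increasing after it, so each side has its own inverse, b1 on the left
    and b2 on the right; hmax is the smaller of the values at the ends t - e and
    t + e, so that both inverses are defined up to hmax. *)
Lemma fold_branches r O a t : (1 < r)%N -> open O -> Cr r O a -> O t ->
  'D_1 a t = 0 -> 0 < 'D_1 (fun s => 'D_1 a s) t ->
  exists e hmax b1 b2,
  [/\ [/\ 0 < e, a t < hmax & `[t - e, t + e] `<=` O],
    forall s, t - e <= s <= t + e -> a t <= a s /\ (a s = a t -> s = t),
    forall h, a t <= h <= hmax ->
      [/\ a (b1 h) = h, a (b2 h) = h, b1 h <= t <= b2 h,
        t - e <= b1 h <= t + e & t - e <= b2 h <= t + e],
    forall s, t - e <= s <= t + e -> a t <= a s <= hmax ->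
      s = b1 (a s) \/ s = b2 (a s) &
    [/\ {within `[a t, hmax], continuous b1}, {within `[a t, hmax], continuous b2},
      Cr r `]a t, hmax[ b1 & Cr r `]a t, hmax[ b2]].
Proof.
move=> r1 oO Ca Ot a0 aa0; have r0 := ltnW r1.
have [e [e0 sO ap an]] := derive_sign_near r1 oO Ca Ot a0 aa0.
have sOr : `[t, t + e] `<=` O.
  by move=> s /=; rewrite in_itv/= => st; apply: sO; rewrite /= in_itv/=; lra.
have apr : {in `]t, t + e[%R, forall s, 0 < 'D_1 a s}.
  by move=> s; rewrite in_itv/= => st; apply: ap; lra.
have ltr : t < t + e by lra.
have [b2 [b2P b2K b2c Cb2]] := inverse_branch r0 ltr oO Ca sOr apr.
have incr := strictly_increasing_on r0 Ca sOr apr.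
(* the left branch is the right branch of the reflected function *)
pose a' (s : R) := a (- s); pose O' := [set s : R | O (- s)].
have CN A : open A -> Cr r A (fun s : R => - s).
  move=> oA; have C1 := Cr_id r A.
  apply: (@Cr_ext _ _ _ _ _ (fun s : R => -1 * s)) => //.
    by move=> s _; rewrite mulN1r.
  by apply: Cr_mul => //; exact: Cr_cst.
have oO' : open O'.
  have := open_preimage_on openT (CN _ openT) oO; by rewrite setTI.
have Ca' : Cr r O' a'.
  apply: (@Cr_comp _ _ _ _ _ _ O (fun s => - s) a) => //.
    exact: finite_coords_R.
  exact: CN.
have sOl : `[- t, - t + e] `<=` O'.
  by move=> s /=; rewrite in_itv/= => st; apply: sO; rewrite /= in_itv/=; lra.
have apl : {in `]- t, - t + e[%R, forall s, 0 < 'D_1 a' s}.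
  move=> s; rewrite in_itv/= => st.
  have Os : O (- s) by apply: sO; rewrite /= in_itv/=; lra.
  have da : differentiable a (- s) by apply: Cr_differentiable r0 Ca Os.
  rewrite derive_reflect; last exact: diff_derivable da.
  by rewrite oppr_gt0; apply: an; lra.
have ltl : - t < - t + e by lra.
have [b [bP bK bc Cb]] := inverse_branch r0 ltl oO' Ca' sOl apl.
have incl := strictly_increasing_on r0 Ca' sOl apl.
have a't : a' (- t) = a t by rewrite /a' opprK.
rewrite a't in bP bc Cb.
pose hmax := Num.min (a (t + e)) (a' (- t + e)).
have hr : hmax <= a (t + e) by rewrite /hmax ge_min lexx.
have hl : hmax <= a' (- t + e) by rewrite /hmax ge_min lexx orbT.
have ah : a t < hmax.
  by rewrite /hmax lt_min incr ?lexx//= -a't incl ?lexx.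
have sub (h : R) : a t <= h -> h <= hmax ->
    (a t <= h <= a (t + e)) /\ (a t <= h <= a' (- t + e)).
  by move=> h1 h2; rewrite !h1 (le_trans h2 hr) (le_trans h2 hl).
exists e, hmax, (fun h => - b h), b2; split.
- by split.
- move=> s st; have [ts|st'|->] := ltgtP t s; last by [].
    have lt : a t < a s by apply: incr; lra.
    by split; [exact: ltW|move=> E; move: lt; rewrite E ltxx].
  have lt : a t < a s.
    by have := incl (- t) (- s); rewrite /a' !opprK; apply; lra.
  by split; [exact: ltW|move=> E; move: lt; rewrite E ltxx].
- move=> h /andP[h1 h2]; have [/b2P[b2h ab2] /bP[bh ab]] := sub h h1 h2.
  by split=> //; lra.
- move=> s st _; have [ts|st'] := leP t s; first by right; rewrite b2K//; lra.
  left; have := bK (- s); rewrite /a' opprK => ->; lra.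
- have wsub : `[a t, hmax] `<=` `[a t, a (t + e)].
    by move=> h /=; rewrite !in_itv/= => /andP[h1 h2]; case: (sub h h1 h2).
  have wsub' : `[a t, hmax] `<=` `[a t, a' (- t + e)].
    by move=> h /=; rewrite !in_itv/= => /andP[h1 h2]; case: (sub h h1 h2).
  have osub : `]a t, hmax[ `<=` `]a t, a (t + e)[.
    by move=> h /=; rewrite !in_itv/=; lra.
  have osub' : `]a t, hmax[ `<=` `]a t, a' (- t + e)[.
    by move=> h /=; rewrite !in_itv/=; lra.
  have oI : open (`]a t, hmax[ : set R) by exact: interval_open.
  split.
  + move=> h; apply: continuousN.
    exact: (continuous_subspaceW wsub' bc).
  + exact: continuous_subspaceW wsub b2c.
  + apply: (@Cr_comp _ _ _ _ _ _ setT b (fun s : R => - s)) => //.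
    * exact: finite_coords_R.
    * exact: Cr_sub osub' Cb.
    * exact: CN openT.
  + exact: Cr_sub osub Cb2.
Qed.

End Branches.

(** * Cardinality and limits *)

Lemma card_three (T : choiceType) (x y z : T) : x != y -> x != z -> y != z ->
  ([set x; y; z] #= `I_3)%card.
Proof.
move=> xy xz yz; pose f i := nth x [:: x; y; z] i.
have -> : [set x; y; z] = f @` `I_3.
  apply/seteqP; split=> [t [[->|->]|->]|_ [[|[|[|//]]] _ <-]] /=.
  - by exists 0%N.
  - by exists 1%N.
  - by exists 2%N.
  - by left; left.
  - by left; right.
  - by right.
apply: inj_card_eq => i j; rewrite !inE /= => i3 j3 /eqP.
rewrite nth_uniq//= ?inE; first by move/eqP.
by rewrite negb_or xy xz yz.
Qed.

Lemma near_image (U V : topologicalType) (f : U -> V) x (Q : set V) :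
  {for x, continuous f} -> (\forall y \near f x, Q y) ->
  \forall z \near x, Q (f z).
Proof. by move=> cf nQ; exact: cf nQ. Qed.

(** * The Poincare map in section coordinates *)

Arguments piter : simpl never.

Section PartialIteration.
Context {T : Type}.
Implicit Types g : T -> option T.

Lemma piterD g a b x : piter (a + b) g x = obind (piter a g) (piter b g x).
Proof.
rewrite /piter iterD; case: (iter b _ _) => //=.
by elim: a => //= a ->.
Qed.

Lemma piterS g m x : piter m.+1 g x = obind g (piter m g x).
Proof. by []. Qed.

Lemma piterSr g m x : piter m.+1 g x = obind (piter m g) (g x).
Proof. by rewrite -[m.+1]addn1 piterD. Qed.

Lemma piter_multiple_fixed g d m x :
  piter d g x = Some x -> piter (m * d) g x = Some x.
Proof. by move=> gx; elim: m => // m IH; rewrite mulSn piterD IH /= gx. Qed.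

End PartialIteration.

Section SectionCoordinates.
Variables (R : realType) (n : nat).
Notation phase := (phase R n).
Notation fullcoord := (fullcoord R n).
Notation seccoord := (seccoord R n).

Lemma finite_coords_phase : finite_coords (phase : normedModType R).
Proof. exact: finite_coords_mx. Qed.

Lemma finite_coords_Rn : finite_coords (Rn R n : normedModType R).
Proof.
apply: finite_coords_prod; [exact: finite_coords_R|exact: finite_coords_mx].
Qed.

Lemma finite_coords_fullcoord : finite_coords (fullcoord : normedModType R).
Proof.
apply: finite_coords_prod; last exact: finite_coords_Rn.
apply: finite_coords_prod; last exact: finite_coords_R.
apply: finite_coords_prod; first exact: finite_coords_R.
exact: finite_coords_Rn.
Qed.

Lemma finite_coords_seccoord : finite_coords (seccoord : normedModType R).
Proof.
apply: finite_coords_prod; first exact: finite_coords_R.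
apply: finite_coords_prod; exact: finite_coords_Rn.
Qed.

Lemma near_p0 (x : seccoord) (Q : set R) :
  (\forall t \near x.1, Q t) -> \forall z \near x, Q z.1.
Proof.
have C := Cr_fst openT (@Cr_id R (seccoord) 0 setT).
by move=> h; exact: (C x I _ h).
Qed.

Lemma near_pq (x : seccoord) (Q : set (pqcoord R n)) :
  (\forall t \near x.2, Q t) -> \forall z \near x, Q z.2.
Proof.
have C := Cr_snd openT (@Cr_id R (seccoord) 0 setT).
by move=> h; exact: (C x I _ h).
Qed.

Lemma near_p1 (x : seccoord) (Q : set R) :
  (\forall t \near x.2.1.1, Q t) -> \forall z \near x, Q z.2.1.1.
Proof.
have C := Cr_snd openT (@Cr_id R (seccoord) 0 setT).
have C' := Cr_fst openT (Cr_fst openT C).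
by move=> h; exact: (C' x I _ h).
Qed.

Lemma near_p2 (x : seccoord) (Q : set 'rV[R]_n.-1) :
  (\forall t \near x.2.1.2, Q t) -> \forall z \near x, Q z.2.1.2.
Proof.
have C := Cr_snd openT (@Cr_id R (seccoord) 0 setT).
have C' := Cr_snd openT (Cr_fst openT C).
by move=> h; exact: (C' x I _ h).
Qed.

Lemma Cr_emb (U : normedModType R) r (A : set U) (f : U -> seccoord) :
  open A -> Cr r A f -> Cr r A (fun x => emb (f x)).
Proof.
move=> oA Cf; have [C1 C2] := (Cr_fst oA Cf, Cr_snd oA Cf).
have [C3 C4] := (Cr_fst oA C2, Cr_snd oA C2).
apply: Cr_pair => //; apply: Cr_pair => //; last exact: Cr_cst.
exact: Cr_pair.
Qed.

Lemma Cr_prj (U : normedModType R) r (A : set U) (f : U -> fullcoord) :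
  open A -> Cr r A f -> Cr r A (fun x => prj (f x)).
Proof.
move=> oA Cf; have [C1 C2] := (Cr_fst oA Cf, Cr_snd oA Cf).
have C3 := Cr_fst oA (Cr_fst oA C1); have C4 := Cr_snd oA (Cr_fst oA C1).
by apply: Cr_pair => //; apply: Cr_pair.
Qed.

Variables (H : phase -> R) (rho rhoV : phase -> phase).
Variables (S : set phase) (P : phase -> option phase).
Hypothesis hs : hamiltonian_setting H rho rhoV S P.
Variable c : local_coords S rho.

Lemma P_section x y : P x = Some y -> S x /\ S y.
Proof.
by move=> /(hs_poincare hs)[Sx [t [u [_ _ _ _ []]]]].
Qed.

(** A 1 x 1 matrix equals its transpose, and J is skew-symmetric. *)
Lemma symplectic_form_alternating (v : phase) :
  ((symplectic_mx R n *m v)^T *m v) 0 0 = 0.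
Proof.
set J := symplectic_mx R n; set a := _ *m v.
have JT : J^T = - J.
  by rewrite /J /symplectic_mx tr_block_mx opp_block_mx !linearN /= !trmx0 !trmx1
    opprK !oppr0.
have aT : a^T = - a.
  by rewrite /a trmx_mul trmxK trmx_mul JT mulmxN mulNmx opprK mulmxA.
have : a 0 0 = - a 0 0 by
  have := congr1 (fun M : 'M[R]_1 => M 0 0) aT; rewrite [LHS]mxE [RHS]mxE.
lra.
Qed.

Lemma ham_field_tangent x : 'd H x (ham_field H x) = 0.
Proof.
have dH : differentiable H x by case: (hs_ham hs) => + _; apply.
rewrite [ham_field H x]matrix_sum_delta linear_sum /=.
rewrite -[RHS](symplectic_form_alternating (gradient H x)).
rewrite !mxE; apply: eq_bigr => i _; rewrite big_ord1 linearZ /=.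
by rewrite mxE -deriveE// /gradient !mxE.
Qed.

(** By the chain rule the derivative of the energy along an orbit of the flow is
    [ham_field_tangent], hence zero. *)
Lemma P_energy x y : P x = Some y -> H y = H x.
Proof.
move=> /(hs_poincare hs)[_ [t [u [t0 <- <- du _]]]].
have dHu s : 0 <= s <= t -> is_derive s 1 (H \o u) 0.
  move=> /du[dus us].
  have /derivable1_diffP dus' := dus.
  have dH : differentiable H (u s) by case: (hs_ham hs) => + _; apply.
  have dHu := differentiable_comp dus' dH.
  split; first exact/derivable1_diffP.
  rewrite (deriveE _ dHu) (diff_comp dus' dH) /= -(deriveE _ dus') us.
  exact: ham_field_tangent.
have cHu : {within `[0, t], continuous (H \o u)}.
  apply: derivable_within_continuous => s; rewrite in_itv/= => /dHu.
  by case.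
have [|s _ e] := @MVT R (H \o u) (fun=> 0) 0 t t0 _ cHu.
  by move=> s; rewrite in_itv/= => /andP[? ?]; apply: dHu; rewrite !ltW.
by move: e; rewrite /= mul0r => /eqP; rewrite subr_eq0 => /eqP.
Qed.

Lemma P_reversible x y : P x = Some y -> P (rho y) = Some (rho x).
Proof.
move=> Pxy; have := @hs_revP _ _ _ _ _ _ _ hs x; rewrite Pxy => /(_ isT) /=.
case: (P (rho y)) => //= w [wx]; congr Some.
by rewrite -wx (hs_invr hs).
Qed.

(** Reversibility says that the reversor conjugates the map to its inverse; this
    carries over to iterates without inverting the partial map. *)
Lemma piterP_reversible m x y :
  piter m P x = Some y -> piter m P (rho y) = Some (rho x).
Proof.
elim: m y => [|m IH] y; first by case=> ->.
rewrite piterS; case E: (piter m P x) => [z|]//= Pzy.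
by rewrite piterSr (P_reversible Pzy) /=; exact: IH.
Qed.

Lemma piterP_section m x y : S x -> piter m P x = Some y -> S y.
Proof.
case: m => [|m] Sx; first by case=> <-.
rewrite piterS; case: (piter m P x) => [z|]//= /P_section[].
by [].
Qed.

Lemma piterP_energy m x y : piter m P x = Some y -> H y = H x.
Proof.
elim: m y => [|m IH] y; first by case=> ->.
rewrite piterS; case E: (piter m P x) => [z|]//= /P_energy ->.
exact: IH.
Qed.

Notation L x := (lc_inv c (emb x)).

Lemma cdom_lift x : cdom c x -> [/\ lc_dom c (L x), lc_map c (L x) = emb x, S (L x)
  & (rho (L x) = L x <-> x.2.2 = 0)].
Proof.
move=> cx; have [dx ex] := lc_invP cx.
split=> //; first by apply/(lc_section dx); rewrite ex.
by split=> [/(lc_fix dx)|x0]; [|apply/(lc_fix dx)]; rewrite ex // => -[].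
Qed.

(** A point of the section has q_0 = 0, so dropping this coordinate loses
    nothing. *)
Lemma cdom_project z : lc_dom c z -> S z ->
  cdom c (prj (lc_map c z)) /\ L (prj (lc_map c z)) = z.
Proof.
move=> dz Sz; have [cz ez] := lc_mapP dz.
have em : emb (prj (lc_map c z)) = lc_map c z.
  have := (lc_section dz).1 Sz.
  by case: (lc_map c z) => [[[a b] d] e] /= ->.
by rewrite /cdom /= em.
Qed.

(** All properties of the map in coordinates are transported along this
    equivalence, which holds because orbits that start on the section stay on it. *)
Lemma Pcoord_someP m x y : Pcoord c P m x = Some y <->
  [/\ cdom c x, cdom c y & piter m P (L x) = Some (L y)].
Proof.
rewrite /Pcoord; split.
  case: asboolP => // cx; have [dx ex Sx _] := cdom_lift cx.
  case E: (piter m P _) => [z|]//=; case: asboolP => // dz [<-].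
  by have [c' ->] := cdom_project dz (piterP_section Sx E).
move=> [cx cy ->]; rewrite asboolT//=; have [dy ey _ _] := cdom_lift cy.
by rewrite asboolT// ey; case: y {cy dy ey} => [a [b d]].
Qed.

Lemma Pcoord_energy m x y :
  Pcoord c P m x = Some y -> energy c H y = energy c H x.
Proof. by move=> /Pcoord_someP[_ _ /piterP_energy]. Qed.

Lemma PcoordD a b x y :
  Pcoord c P b x = Some y -> Pcoord c P a y = Pcoord c P (a + b) x.
Proof.
move=> /Pcoord_someP[cx cy e].
by rewrite /Pcoord !asboolT// piterD e.
Qed.

Lemma Pcoord0 x : cdom c x -> Pcoord c P 0 x = Some x.
Proof. by move=> cx; apply/Pcoord_someP. Qed.

Lemma Pcoord_multiple_fixed d m x :
  Pcoord c P d x = Some x -> Pcoord c P (m * d) x = Some x.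
Proof.
move=> /Pcoord_someP[cx _ e]; apply/Pcoord_someP; split=> //.
exact: piter_multiple_fixed.
Qed.

Lemma Pcoord_sym_back m x y : x.2.2 = 0 -> y.2.2 = 0 ->
  Pcoord c P m x = Some y -> Pcoord c P m y = Some x.
Proof.
move=> x0 y0 /Pcoord_someP[cx cy e]; apply/Pcoord_someP; split => //.
have [_ _ _ /iffRL/(_ x0) rx] := cdom_lift cx.
have [_ _ _ /iffRL/(_ y0) ry] := cdom_lift cy.
by rewrite -ry (piterP_reversible e) rx.
Qed.

(** If P^(2m) x = x, reversing the orbit segment from x to y = P^m x shows that
    P^m maps x to the mirror image of y; so y is its own mirror image.  The
    converse is [Pcoord_sym_back]. *)
Lemma Pcoord_sym_fixed m x y : x.2.2 = 0 -> Pcoord c P m x = Some y ->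
  (Pcoord c P (2 * m) x = Some x <-> y.2.2 = 0).
Proof.
move=> x0 xy; rewrite mul2n -addnn -(PcoordD _ xy); split; last first.
  by move=> y0; exact: Pcoord_sym_back xy.
move=> /Pcoord_someP[cy cx /piterP_reversible].
have [_ _ _ /iffRL/(_ x0) rx] := cdom_lift cx.
have [_ _ _ <-] := cdom_lift cy.
have /Pcoord_someP[_ _ e] := xy.
by rewrite rx e => -[].
Qed.

Lemma open_cdom : open (cdom c).
Proof.
have := @open_preimage_on _ _ _ 0 setT (lc_cod c) (@emb R n) openT _
  (@lc_cod_open _ _ _ _ c).
rewrite setTI; apply; apply: (@Cr_emb _ 0 setT id openT); exact: Cr_id.
Qed.

Lemma Cr_lift : Cr 3 (cdom c) (fun x : seccoord => L x).
Proof.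
apply: (@Cr_comp _ _ _ _ _ _ (lc_cod c) (@emb R n) (lc_inv c)) => //.
- exact: finite_coords_fullcoord.
- exact: open_cdom.
- by apply: (@Cr_emb _ 3 _ id); [exact: open_cdom|exact: Cr_id].
- exact: lc_inv_smooth.
Qed.

Lemma Cr_energy : Cr 3 (cdom c) (energy c H).
Proof.
apply: (@Cr_comp _ _ _ _ _ _ setT (fun x : seccoord => L x) H) => //.
- exact: finite_coords_phase.
- exact: open_cdom.
- exact: Cr_lift.
- exact/CrS/(hs_ham hs).
Qed.

(** On the section the partial map agrees with an ambient smooth map on its domain,
    and this passes to iterates; this gives an open set in phase space, to which
    the calculus of C^r maps applies. *)
Lemma piterP_Cr m : exists (A : set phase) (F : phase -> phase),
  [/\ open A, Cr 3 A F, forall x, S x -> (isSome (piter m P x) <-> A x)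
    & forall x, S x -> A x -> piter m P x = Some (F x)].
Proof.
have [D [F [oD CF PD PF]]] := hs_smooth hs.
elim: m => [|m [A [G [oA CG AP AG]]]].
  exists setT, id; split=> //; [exact: openT|exact: Cr_id].
exists (A `&` G @^-1` D), (F \o G).
have oAD := open_preimage_on oA CG oD.
have sub : A `&` G @^-1` D `<=` A by move=> ? [].
split=> //.
- apply: (@Cr_comp _ _ _ _ _ _ D) CF => //; first exact: finite_coords_phase.
    by move=> x [].
  exact: Cr_sub CG.
- move=> x Sx; rewrite piterS; split.
    case E : (piter m P x) => [z|]//= /PD[Sz Dz].
    have Ax : A x by apply/(AP _ Sx); rewrite E.
    by split=> //=; have := AG x Sx Ax; rewrite E => -[<-].
  move=> [Ax /= DGx]; rewrite (AG x Sx Ax) /=; apply/PD; split=> //.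
  exact: piterP_section Sx (AG x Sx Ax).
- move=> x Sx [Ax /= DGx]; rewrite piterS (AG x Sx Ax) /=.
  by apply: PF => //; exact: piterP_section Sx (AG x Sx Ax).
Qed.

Lemma Pcoord_Cr m : exists (A : set seccoord) (F : seccoord -> seccoord),
  [/\ open A, Cr 3 A F, forall x, (isSome (Pcoord c P m x) <-> A x)
    & forall x, A x -> Pcoord c P m x = Some (F x)].
Proof.
have [A [F [oA CF AP AF]]] := piterP_Cr m.
pose B := cdom c `&` (fun x => L x) @^-1` A.
have oB : open B by apply: open_preimage_on Cr_lift oA; exact: open_cdom.
have CB : Cr 3 B (fun x => F (L x)).
  apply: (@Cr_comp _ _ _ _ _ _ A (fun x : seccoord => L x)) CF => //.
  - exact: finite_coords_phase.
  - by move=> x [].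
  - by apply: Cr_sub Cr_lift => x [].
pose D := B `&` (fun x => F (L x)) @^-1` (lc_dom c).
have oD : open D by apply: open_preimage_on CB _ => //; exact: lc_dom_open.
have DF x : D x -> Pcoord c P m x = Some (prj (lc_map c (F (L x)))).
  move=> [[cx Ax] dFx]; have [_ _ Sx _] := cdom_lift cx.
  by rewrite /Pcoord asboolT// (AF _ Sx Ax)/= asboolT.
exists D, (fun x => prj (lc_map c (F (L x)))); split=> //.
- apply: Cr_prj => //.
  apply: (@Cr_comp _ _ _ _ _ _ (lc_dom c) (fun x => F (L x))) => //.
  + exact: finite_coords_phase.
  + by move=> x [].
  + by apply: Cr_sub CB => x [].
  + exact: lc_map_smooth.
- move=> x; split; last by move=> /DF ->.
  case E: (Pcoord c P m x) => [y|]// _.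
  move/Pcoord_someP: E => [cx cy e]; have [_ _ Sx _] := cdom_lift cx.
  have Ax : A (L x) by apply/(AP _ Sx); rewrite e.
  split; first by split.
  have := AF _ Sx Ax; rewrite e /= => -[<-].
  by have [] := cdom_lift cy.
Qed.

End SectionCoordinates.

(** * Factoring out a known zero *)

Section Hadamard.
Context {R : realType}.

(** Both sides are limits of the same difference quotient, here and in
    [partial1E]. *)
Lemma partial0E (F : R -> R -> R) a b :
  partial0 F a b = 'D_(1, 0) (fun z : R * R => F z.1 z.2) (a, b).
Proof.
rewrite /partial0 /derive1 /derive; apply: (congr1 (fun g : R -> R => lim (g @ 0^')));
  apply/funext => h /=.
by rewrite [h *: 0]scaler0 add0r [h *: 1]mulr1.
Qed.

Lemma partial1E (F : R -> R -> R) a b :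
  partial1 F a b = 'D_(0, 1) (fun z : R * R => F z.1 z.2) (a, b).
Proof.
rewrite /partial1 /derive1 /derive; apply: (congr1 (fun g : R -> R => lim (g @ 0^')));
  apply/funext => h /=.
by rewrite [h *: 0]scaler0 add0r [h *: 1]mulr1.
Qed.

(** Taylor's formula of order zero with integral remainder.  Written as a product
    with x1 - x0, it is the factorization of a function that vanishes at x0. *)
Lemma increment_integral (O : set R) (f : R -> R) x0 x1 :
  open O -> Cr 1 O f -> (forall t : R, 0 <= t <= 1 -> O (x0 + t * (x1 - x0))) ->
  f x1 - f x0 =
  (x1 - x0) * \int[lebesgue_measure]_(t in `[0, 1]) derive1 f (x0 + t * (x1 - x0)).
Proof.
move=> oO Cf lO; set d := x1 - x0; pose l (t : R) : R := x0 + t * d.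
have lO' (t : R) : t \in `[0, 1]%R -> O (l t) by rewrite in_itv/=; exact: lO.
have dl (t : R) : is_derive t 1 l d.
  by apply: is_derive_eq; rewrite scaler0 !add0r mul1r [LHS]mulr1.
have df (t : R) : t \in `[0, 1]%R -> is_derive t 1 (f \o l) (d * derive1 f (l t)).
  move=> t01; have [dlt dlE] := dl t.
  have dft : derivable f (l t) 1.
    exact/diff_derivable/(Cr_differentiable _ Cf)/lO'.
  split.
    apply/derivable1_diffP; apply: differentiable_comp.
      exact: (derivable1_diffP _ _).1 dlt.
    exact: (derivable1_diffP _ _).1 dft.
  rewrite -derive1E (derive1_comp dlt dft) mulrC; congr (_ * _).
  by rewrite derive1E.
have cg (t : R) : t \in `[0, 1]%R -> {for t, continuous (fun t : R => derive1 f (l t))}.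
  move=> t01; have -> : (fun t : R => derive1 f (l t)) = (fun x => 'D_1 f x) \o l.
    by apply/funext => s; rewrite derive1E.
  apply: continuous_comp.
    by apply/differentiable_continuous/derivable1_diffP; case: (dl t).
  by apply: (Cr_continuous (r := 0) (D := O)); [exact: Cr_derive Cf|exact: lO'].
have cgw : {within `[0, 1], continuous (fun t : R => derive1 f (l t))}.
  by apply: continuous_in_subspaceT => t; rewrite inE => /cg.
have cF : derivable_oo_LRcontinuous (f \o l) 0 1.
  have cont (t : R) : t \in `[0, 1]%R -> {for t, continuous (f \o l)}.
    by move=> /df[dt _]; apply/differentiable_continuous/derivable1_diffP.
  split.
  - by move=> t /subset_itv_oo_cc/df[].
  - by apply: cvg_at_right_filter; apply: cont; rewrite bound_itvE.
  - by apply: cvg_at_left_filter; apply: cont; rewrite bound_itvE.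
have cdg : {within `[0, 1], continuous (fun t : R => d * derive1 f (l t))}.
  apply: continuous_in_subspaceT => t; rewrite inE => /cg ct.
  apply: (@continuousZ _ R^o _ (fun=> d) (fun t : R => derive1 f (l t)) t _ ct).
  exact: cvg_cst.
have dF : {in `]0, 1[%R, derive1 (f \o l) =1 (fun t : R => d * derive1 f (l t))}.
  by move=> t /subset_itv_oo_cc/df[_ <-]; rewrite derive1E.
have l1 : l 1 = x1 by rewrite /l mul1r addrC subrK.
have l0 : l 0 = x0 by rewrite /l mul0r addr0.
have /(congr1 fine) := continuous_FTC2 ltr01 cdg cF dF.
rewrite -/(Rintegral _ _ _) /= l1 l0 => <-.
rewrite RintegralZl//.
by apply: continuous_compact_integrable => //; exact: segment_compact.
Qed.

End Hadamard.

(** * Symmetric periodic points *)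

Section SymmetricFixedPoints.
Variables (R : realType) (n r k : nat).
Variables (H : phase R n -> R) (rho rhoV : phase R n -> phase R n).
Variables (S : set (phase R n)) (P : phase R n -> option (phase R n)).
Variable c : local_coords S rho.
Variables (P0 P1 : set R) (P2 : set 'rV[R]_n.-1).
Variables (p1c : R -> R) (p2c : R -> 'rV[R]_n.-1).
Variables (p2H : R * R -> 'rV[R]_n.-1) (p0b : R -> R).
Variables (p0s p1s : R).
Hypothesis r23 : (2 <= r <= 3)%N.
Hypothesis k_gt1 : (1 < k)%N.
Hypothesis k_even : ~~ odd k.
Hypothesis hs : hamiltonian_setting H rho rhoV S P.
Hypothesis hfix : fixed_curve c P r k P0 P1 P2 p1c p2c.
Hypothesis h2 : HC2 c P r k P0 P1 P2 p1c p2H.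
Hypothesis h3 : HC3 c P r k P0 P1 p1c p2H p0b.
Hypothesis h4 : HC4 c P k P0 P1 p1c p2H.
Hypothesis P0s : P0 p0s.
Hypothesis P1s : P1 p1s.
Hypothesis p1sE : p1s = p1c p0s.
Hypothesis p0sE : p0s = p0b p1s.

Notation xfp := (xfpH p1c p2c : R -> seccoord R n).
Notation xb := (xbH p2H p0b : R -> seccoord R n).
Notation box := (symbox P0 P1 P2).
Notation Pc m := (Pcoord c P m).
Notation G := (GkH c P k p2H).

Lemma r_ge2 : (2 <= r)%N. Proof. by case/andP: r23. Qed.

Lemma half_k : (k./2 * 2)%N = k.
Proof. by rewrite muln2 even_halfK. Qed.

Lemma P1_curve p0 : P0 p0 -> P1 (p1c p0).
Proof. by case: h2 => _ h _ _ _ /h; exact: interior_subset. Qed.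

Lemma P2_sym p0 p1 : P0 p0 -> P1 p1 -> P2 (p2H (p0, p1)).
Proof. by case: h2 => _ _ _ h _ h0 h1; apply: interior_subset; exact: h. Qed.

Lemma P0_branch p1 : P1 p1 -> P0 (p0b p1).
Proof. by case: h3 => _ h _ /h. Qed.

Lemma fixed_curve_fixed p0 : P0 p0 -> box (xfp p0) /\ Pc 2 (xfp p0) = Some (xfp p0).
Proof.
move=> h0; have [_ _ _ _ hF] := hfix.
have : (xfp @` P0) (xfp p0) by exists p0.
rewrite -(hF 1%N); last by move: k_gt1; lia.
by case.
Qed.

(** Here k is even, so that P^k is an iterate of P^2. *)
Lemma fixed_curve_Pk p0 : P0 p0 -> Pc k (xfp p0) = Some (xfp p0).
Proof.
move=> /fixed_curve_fixed[_ h]; rewrite -half_k; exact: (Pcoord_multiple_fixed hs).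
Qed.

Lemma low_period_fixed i x : (0 < i < k)%N -> box x ->
  Pc (2 * i) x = Some x <-> exists2 p0, P0 p0 & x = xfp p0.
Proof.
move=> ik bx; have [_ _ _ _ /(_ i)F'] := hfix.
have F : Fix (Pc (2 * i)) box setT = xfp @` P0 by apply: F'; move: ik k_gt1; lia.
split=> [Px|[p0 h0 ex]].
  have : Fix (Pc (2 * i)) box setT x by split.
  by rewrite F => -[p0 h0 <-]; exists p0.
have : (xfp @` P0) x by exists p0.
by rewrite -F => -[].
Qed.

Lemma symmetric_image p0 p1 p2 : P0 p0 -> P1 p1 -> P2 p2 ->
  exists2 y, Pc k (sympt p0 p1 p2) = Some y &
    (y.2.2 = 0 <-> p2 = p2H (p0, p1) /\ G p0 p1 = 0).
Proof.
move=> h0 h1 hp2; have [_ _ _ _ /(_ _ _ _ h0 h1 hp2)[y Py y2]] := h2.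
exists y => //; split=> [y0|[e2 G0]].
  have e2 : p2 = p2H (p0, p1) by apply/y2; rewrite y0.
  by split=> //; rewrite /GkH -e2 Py y0.
move: G0; rewrite /GkH -e2 Py; have := y2.2 e2.
by case: (y.2.2) => /= a b -> ->.
Qed.

(** A point of the curve is its own image under P^k, and it is symmetric. *)
Lemma fixed_curve_sym p0 : P0 p0 ->
  p2c p0 = p2H (p0, p1c p0) /\ G p0 (p1c p0) = 0.
Proof.
move=> h0; have [[_ h1 hp2 _] _] := fixed_curve_fixed h0.
have [y] := symmetric_image h0 h1 hp2.
rewrite -/(xfpH p1c p2c p0) (fixed_curve_Pk h0) => -[<-] /= h.
exact/h.
Qed.

(** Openness of the domain of P^k and of the domain on which p_2^H extends
    smoothly gives a full neighbourhood of P_0 x P_1, even at the endpoints of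
    P_1. *)
Lemma GkH_Cr : exists2 O : set (R * R), open O /\ P0 `*` P1 `<=` O &
  Cr r O (fun z => G z.1 z.2).
Proof.
have [_ _ [D [oD sD CD]] hP2 hk] := h2.
have [A [F [oA CF PA FA]]] := Pcoord_Cr hs c k.
pose s (z : R * R) : seccoord R n := sympt z.1 z.2 (p2H z).
have Cs : Cr r D s.
  have C12 := Cr_id r D.
  apply: Cr_pair => //; first exact: (Cr_fst oD C12).
  apply: Cr_pair => //; last exact: Cr_cst.
  by apply: Cr_pair => //; exact: (Cr_snd oD C12).
have oDA := open_preimage_on oD Cs oA.
exists (D `&` s @^-1` A).
  split=> // z hz; split; first exact: sD.
  have [h0 h1] := hz.
  apply/PA; have := @symmetric_image z.1 z.2 (p2H z) h0 h1.
  by move=> [|y -> //]; exact: interior_subset (hP2 _ hz).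
apply: (@Cr_ext _ _ _ _ _ (fun z => (F (s z)).2.2.1)) => //.
  by move=> [a b] [_ /FA]; rewrite /GkH /s /= => ->.
have CFs : Cr r (D `&` s @^-1` A) (F \o s).
  apply: (@Cr_comp _ _ _ _ _ _ A) => //.
  - exact: finite_coords_seccoord.
  - by move=> ? [].
  - by apply: Cr_sub Cs => ? [].
  - by apply: Cr_leq CF; case/andP: r23.
have := Cr_fst oDA (Cr_snd oDA (Cr_snd oDA CFs)).
exact.
Qed.

Lemma segment_in_P1 p0 p1 t : P0 p0 -> P1 p1 -> 0 <= t <= 1 ->
  P1 (p1c p0 + t * (p1 - p1c p0)).
Proof.
move=> h0 h1 t01; have [[iP1 _ _] _ _ _ _] := h2.
have h1c := P1_curve h0.
have [le|/ltW le] := leP (p1c p0) p1.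
  by apply: (iP1 _ _ h1c h1); nra.
by apply: (iP1 _ _ h1 h1c); nra.
Qed.

Lemma GkH_factor p0 p1 : P0 p0 -> P1 p1 ->
  G p0 p1 = (p1 - p1c p0) * gkH c P k p1c p2H p0 p1.
Proof.
move=> h0 h1; have [Q [oQ sQ] CQ] := GkH_Cr.
pose s (p : R) := (p0, p).
have Cs : Cr 1 setT s by apply: Cr_pair openT _ _; [exact: Cr_cst|exact: Cr_id].
have oQs := open_preimage_on openT Cs oQ.
have CG : Cr 1 (setT `&` s @^-1` Q) (G p0).
  apply: (@Cr_comp _ _ _ _ _ _ Q s (fun z => G z.1 z.2)) => //.
  - apply: finite_coords_prod; exact: finite_coords_R.
  - by move=> ? [].
  - by apply: Cr_sub Cs => ? [].
  - exact: Cr_leq (ltnW r_ge2) CQ.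
have := @increment_integral R _ (G p0) (p1c p0) p1 oQs CG.
have [_ ->] := fixed_curve_sym h0; rewrite subr0 /gkH /partial1; apply.
by move=> t t01; split => //; apply: sQ; split => //; exact: segment_in_P1.
Qed.

Lemma gkH_zero p0 p1 : P0 p0 -> P1 p1 ->
  gkH c P k p1c p2H p0 p1 = 0 <-> p0 = p0b p1.
Proof.
move=> h0 h1; have [_ _ F] := h3; split=> [g0|->].
  have : [set z | (P0 `*` P1) z /\ gkH c P k p1c p2H z.1 z.2 = 0] (p0, p1) by [].
  by rewrite F => -[q _ [<- <-]].
have : [set (p0b p1, p1) | p1 in P1] (p0b p1, p1) by exists p1.
by rewrite -F => -[].
Qed.

Lemma GkH_zero p0 p1 : P0 p0 -> P1 p1 ->
  G p0 p1 = 0 <-> p1 = p1c p0 \/ p0 = p0b p1.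
Proof.
move=> h0 h1; rewrite (GkH_factor h0 h1); split.
  move=> /eqP; rewrite mulf_eq0 subr_eq0 => /orP[/eqP|/eqP/(gkH_zero h0 h1)].
    by left.
  by right.
by case=> [->|/(gkH_zero h0 h1) ->]; rewrite ?subrr ?mul0r ?mulr0.
Qed.

Lemma box_fixed x : box x -> Pc (2 * k) x = Some x <->
  (exists2 p0, P0 p0 & x = xfp p0) \/ (exists2 p1, P1 p1 & x = xb p1).
Proof.
move: x => [p0 [[p1 p2] q]] [/= h0 h1 hp2 ->] {q}; rewrite -/(sympt p0 p1 p2).
have [y Py yE] := symmetric_image h0 h1 hp2.
have -> := Pcoord_sym_fixed hs _ Py; last by [].
rewrite yE (GkH_zero h0 h1); split.
  move=> [-> [e|e]]; [left; exists p0 => //|right; exists p1 => //].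
    by rewrite /xfpH (fixed_curve_sym h0).1 -e.
  by rewrite /xbH -e.
case=> -[q hq [-> -> ->]].
  by rewrite (fixed_curve_sym hq).1; split=> //; left.
by split=> //; right.
Qed.

(** At an intersection g_k vanishes on the curve x_fp, where it equals the partial
    derivative of G in p_1.  The derivative of this function along the curve is
    the sum that (HC4) keeps nonzero, so Rolle's theorem excludes two zeros. *)
Lemma intersection_unique p0 : P0 p0 -> p0 = p0b (p1c p0) -> p0 = p0s.
Proof.
have [Q [oQ sQ] CQ] := GkH_Cr.
have [iP0 oP0 Sp1c _ _] := hfix.
have [Dc [oDc sDc Cc]] := Sp1c.
pose K z := 'D_(0, 1 : R) (fun z : R * R => G z.1 z.2) z.
pose phi p := K (p, p1c p).
have CK : Cr 1 Q K by apply: Cr_derive; exact: Cr_leq r_ge2 CQ.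
have phi0 p : P0 p -> p = p0b (p1c p) -> phi p = 0.
  move=> hp /(gkH_zero hp (P1_curve hp)).
  rewrite /gkH subrr; under eq_Rintegral => t _ do rewrite mulr0 addr0.
  have m1 : fine (lebesgue_measure (`[0, 1] : set R)) = 1.
    by rewrite lebesgue_measure_itv/= lte_fin ltr01 -EFinB/= subr0.
  by rewrite Rintegral_cst// [fine _](m1) mulr1 partial1E.
have dphi p : P0 p -> is_derive p 1 phi
    (partial0 (partial1 G) p (p1c p) + partial1 (partial1 G) p (p1c p) * 'D_1 p1c p).
  move=> hp; have Qp : Q (p, p1c p) by apply: sQ; split => //; exact: P1_curve.
  have dK : differentiable K (p, p1c p) by exact: Cr_differentiable CK Qp.
  have dc : differentiable p1c p.
    by apply: Cr_differentiable (ltnW r_ge2) Cc _; exact: sDc.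
  have ds : differentiable (fun p => (p, p1c p)) p.
    by apply: differentiable_pair => //; exact: ex_diff.
  have dp := @differentiable_comp _ _ _ _ (fun p => (p, p1c p)) K p ds dK.
  have KE : (fun z : R * R => partial1 G z.1 z.2) = K.
    by apply/funext => -[a b]; rewrite /K partial1E.
  split; first exact: diff_derivable dp.
  have di : differentiable (fun p : R => p) p by exact: ex_diff.
  rewrite (deriveE _ dp) (diff_comp ds dK) /= (diff_pair di dc) -(deriveE _ dc).
  have -> : 'd (fun p : R => p) p 1 = 1 by rewrite -(deriveE _ di) derive_id.
  rewrite partial0E partial1E KE (deriveE _ dK) (deriveE _ dK).
  set a := 'D_1 p1c p.
  rewrite mulrC [X in _ + X](_ : _ = 'd K (p, p1c p) (a *: (0, 1))); last first.
    by rewrite linearZ.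
  by rewrite -linearD; congr ('d K _ (_, _)); rewrite /= ?scaler0 ?addr0 // add0r
    [RHS]mulr1.
have nz p : P0 p -> 'D_1 phi p != 0.
  move=> hp; have [_ ->] := dphi p hp; apply/eqP => e; apply: h4; rewrite -e.
  have bp : (P0 `*` P1) (p, p1c p) by split=> //; exact: P1_curve.
  exists (partial0 (partial1 G) p (p1c p)); first by exists (p, p1c p).
  exists (partial1 (partial1 G) p (p1c p) * 'D_1 p1c p) => //.
  exists (partial1 (partial1 G) p (p1c p)); first by exists (p, p1c p).
  by exists ('D_1 p1c p) => //; exists p => //; rewrite derive1E.
have noroll a b : P0 a -> P0 b -> a < b -> phi a = 0 -> phi b = 0 -> False.
  move=> ha hb ab fa fb.
  have inP0 x : x \in `[a, b]%R -> P0 x.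
    by rewrite in_itv/=; exact: (iP0 a b ha hb).
  have [] := @Rolle R phi a b ab.
  - by move=> x /subset_itv_oo_cc/inP0/dphi[].
  - by apply: derivable_within_continuous => x /inP0/dphi[].
  - by rewrite fa fb.
  - by move=> x /subset_itv_oo_cc/inP0/nz/eqP xn [_]; exact: xn.
move=> hp e; have f0 := phi0 _ hp e.
have fs : phi p0s = 0 by apply: phi0 => //; rewrite -p1sE.
have [lt|lt|//] := ltgtP p0 p0s.
  by case: (noroll _ _ hp P0s lt f0 fs).
by case: (noroll _ _ P0s hp lt fs f0).
Qed.

Lemma branch_meets_curve p0 p1 : P0 p0 -> xb p1 = xfp p0 -> p1 = p1s.
Proof.
move=> h0 [e0 e1 _]; rewrite p1sE e1; congr p1c.
by apply: intersection_unique => //; rewrite -e1 e0.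
Qed.

Lemma branch_box p1 : P1 p1 -> box (xb p1).
Proof.
by move=> h1; have h0 := P0_branch h1; split=> //=; exact: P2_sym.
Qed.

Lemma branch_start : xb p1s = xfp p0s.
Proof. by rewrite /xbH /xfpH -p0sE (fixed_curve_sym P0s).1 -p1sE. Qed.

(** P^k moves every point of the branch other than the start: as 0 < k/2 < k, a
    point fixed by P^k lies on x_fp.  The image does not lie on x_fp either,
    since P^k fixes that curve pointwise and undoes itself on symmetric points. *)
Lemma branch_image p1 : P1 p1 -> exists y, [/\ Pc k (xb p1) = Some y, y.2.2 = 0,
  p1 != p1s -> y != xb p1, Pc k y = Some (xb p1) &
  p1 != p1s -> forall p0, P0 p0 -> y <> xfp p0].
Proof.
move=> h1; have bx := branch_box h1; have h0 := P0_branch h1.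
have [y Py yE] := symmetric_image h0 h1 (P2_sym h0 h1).
have y0 : y.2.2 = 0 by apply/yE; split=> //; apply/(GkH_zero h0 h1); right.
have Py' : Pc k y = Some (xb p1) by exact: (Pcoord_sym_back hs _ y0 Py).
exists y; split=> // p1n.
  apply/eqP => yx; have : Pc (2 * k./2) (xb p1) = Some (xb p1).
    by rewrite mulnC half_k -{2}yx.
  move=> /(low_period_fixed _ bx)[|p0 hp0 e].
    by rewrite half_gt0 k_gt1 -divn2 ltn_Pdiv// ltnW.
  by move/eqP: p1n; apply; exact: branch_meets_curve e.
move=> p0 hp0 yx; have := fixed_curve_Pk hp0; rewrite -yx Py' => -[e].
by move/eqP: p1n; apply; apply: (branch_meets_curve hp0); rewrite e.
Qed.

(** * Energy along the two curves *)

Lemma Cr_fixed_curve : Cr r P0 xfp.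
Proof.
have [_ oP0 [A [oA sA CA]] [B [oB sB CB]] _] := hfix.
apply: Cr_pair => //; first exact: Cr_id.
apply: Cr_pair => //; last exact: Cr_cst.
by apply: Cr_pair => //; [exact: Cr_sub sA CA|exact: Cr_sub sB CB].
Qed.

Lemma Cr_branch : Cr r P1° xb.
Proof.
have [[A [oA sA CA]] hA _] := h3.
have [_ _ [B [oB sB CB]] _ _] := h2.
have oP : open P1° by exact: open_interior.
have sP : P1° `<=` A by apply: subset_trans sA; exact: interior_subset.
have C0 := Cr_sub sP CA.
have C1 : Cr r P1° (id : R -> R) by exact: Cr_id.
have C2 : Cr r P1° (fun p => p2H (p0b p, p)).
  apply: (@Cr_comp _ _ _ _ _ _ B (fun p => (p0b p, p)) p2H) => //.
  - apply: finite_coords_prod; exact: finite_coords_R.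
  - move=> p /interior_subset hp; apply: sB; split=> //; exact: P0_branch.
  - exact: Cr_pair.
apply: Cr_pair => //; apply: Cr_pair => //; last exact: Cr_cst.
exact: Cr_pair.
Qed.

Lemma box_cdom x : box x -> cdom c x.
Proof.
move: x => [p0 [[p1 p2] q]] [/= h0 h1 hp2 ->].
by have [y /(Pcoord_someP hs)[]] := symmetric_image h0 h1 hp2.
Qed.

Lemma Cr_hfp : Cr r P0 (hfp c H p1c p2c).
Proof.
have [_ oP0 _ _ _] := hfix.
apply: (@Cr_comp _ _ _ _ _ _ (cdom c) xfp (energy c H)) => //.
- exact: finite_coords_seccoord.
- by move=> p /fixed_curve_fixed[/box_cdom].
- exact: Cr_fixed_curve.
- by apply: Cr_leq (Cr_energy hs c); case/andP: r23.
Qed.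

Lemma Cr_hb : Cr r P1° (hb c H p2H p0b).
Proof.
apply: (@Cr_comp _ _ _ _ _ _ (cdom c) xb (energy c H)) => //.
- exact: finite_coords_seccoord.
- exact: open_interior.
- by move=> p /interior_subset/branch_box/box_cdom.
- exact: Cr_branch.
- by apply: Cr_leq (Cr_energy hs c); case/andP: r23.
Qed.

Lemma P1s_interior : P1° p1s.
Proof. by have [_ h _ _ _] := h2; rewrite p1sE; exact: h. Qed.

(** The parameter p_1^* is interior to P_1, and p_2^H takes interior values of P_2,
    so the only constraint of the box that is not open is q = 0. *)
Lemma box_near : \forall x \near xb p1s, x.2.2 = 0 -> box x.
Proof.
have [_ oP0 _ _ _] := hfix; have [_ _ _ hP2 _] := h2.
have n0 : \forall x \near xb p1s, P0 x.1.
  by apply: near_p0; apply: open_nbhs_nbhs; split=> //=; rewrite -p0sE.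
have n1 : \forall x \near xb p1s, P1 x.2.1.1.
  by apply: near_p1; exact: P1s_interior.
have n2 : \forall x \near xb p1s, P2 x.2.1.2.
  apply: near_p2.
  by apply: hP2; split=> //=; rewrite -p0sE.
by near=> x => x0; split=> //; near: x.
Unshelve. all: by end_near. Qed.

Lemma Pcoord_near m x y (Q : set (seccoord R n)) : Pc m x = Some y ->
  (\forall z \near y, Q z) ->
  \forall z \near x, exists2 w, Pc m z = Some w & Q w.
Proof.
move=> xy nQ; have [A [F [oA CF PA FA]]] := Pcoord_Cr hs c m.
have Ax : A x by apply/PA; rewrite xy.
have Fx : F x = y by have := FA x Ax; rewrite xy => -[].
have nF : \forall z \near x, Q (F z).
  by have := Cr_continuous CF Ax; apply; rewrite Fx.
near=> z; have Az : A z by near: z; exact: open_nbhs_nbhs.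
by exists (F z); [exact: FA|near: z].
Unshelve. all: by end_near. Qed.

Lemma branch_image_in_box p1 y : P1 p1 -> p1 != p1s ->
  Pc k (xb p1) = Some y -> box y ->
  exists p1', [/\ P1 p1', p1' != p1 & y = xb p1'].
Proof.
move=> h1 n1 Py yb; have [y' []] := branch_image h1.
rewrite Py => -[<-] y0 /(_ n1) yn Py' /(_ n1) nc.
have /(box_fixed yb) : Pc (2 * k) y = Some y.
  by apply/(Pcoord_sym_fixed hs _ Py'); [|].
case=> [[p0 hp0 /(nc _ hp0)[]]|[p1' hp1' yE]].
exists p1'; split=> //; apply: contra yn => /eqP <-.
by rewrite yE.
Qed.

(** If the derivative were nonzero at p_1^*, then h_b would be injective nearby
    by Rolle's theorem; but P^k pairs nearby distinct points of the branch, and it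
    preserves the energy. *)
Lemma hb_critical : 'D_1 (hb c H p2H p0b) p1s = 0.
Proof.
apply/eqP/negPn/negP => nz; have Chb := Cr_hb.
pose dh p := 'D_1 (hb c H p2H p0b) p.
have Cdh : Cr 1 P1° dh by apply: Cr_derive; exact: Cr_leq r_ge2 Chb.
have nzn : \forall p \near p1s, P1° p /\ dh p != 0.
  near=> p; split.
    by near: p; apply: open_nbhs_nbhs; split;
      [exact: open_interior|exact: P1s_interior].
  near: p; have := Cr_continuous Cdh P1s_interior.
  by move=> /(_ [set x | x != 0]); apply; exact: open_nbhs_nbhs.
have [e /= e0 eQ] := nzn.
have inj p q : `|p1s - p| < e -> `|p1s - q| < e -> p < q ->
    hb c H p2H p0b p != hb c H p2H p0b q.
  move=> pe qe pq; apply/eqP => hpq.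
  have inQ x : x \in `[p, q]%R -> P1° x /\ dh x != 0.
    rewrite in_itv/= => /andP[px xq]; apply: eQ => /=.
    by move: pe qe; rewrite !ltr_norml; lra.
  have dx x : x \in `[p, q]%R -> derivable (hb c H p2H p0b) x 1.
    move=> /inQ[hx _]; apply/diff_derivable.
    exact: Cr_differentiable (ltnW r_ge2) Chb hx.
  have [] := Rolle pq _ _ hpq.
  - by move=> x /subset_itv_oo_cc/dx.
  - by apply: derivable_within_continuous => x /dx.
  - by move=> x /subset_itv_oo_cc/inQ[_ /eqP xn] [_]; exact: xn.
have Pks : Pc k (xb p1s) = Some (xb p1s).
  by rewrite branch_start; exact: fixed_curve_Pk.
have nx : \forall x \near xb p1s, (x.2.2 = 0 -> box x) /\ `|p1s - x.2.1.1| < e.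
  near=> x; split; first by near: x; exact: box_near.
  near: x; apply: (@near_p1 _ _ _ (fun t => `|p1s - t| < e)) => /=.
  by exists e.
have /(Pcoord_near Pks) nP := nx.
have np : \forall p \near p1s, exists2 w, Pc k (xb p) = Some w &
    (w.2.2 = 0 -> box w) /\ `|p1s - w.2.1.1| < e.
  exact: (Cr_continuous Cr_branch P1s_interior nP).
have [d /= d0 dQ] := np.
pose p := p1s + Num.min d e / 2.
have m0 : 0 < Num.min d e by rewrite lt_min d0 e0.
have md : Num.min d e <= d by rewrite ge_min lexx.
have me : Num.min d e <= e by rewrite ge_min lexx orbT.
have pd : `|p1s - p| < d by rewrite /p ltr_norml; lra.
have pe : `|p1s - p| < e by rewrite /p ltr_norml; lra.
have pn : p != p1s by rewrite /p; apply/eqP; lra.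
have hp : P1 p by apply: interior_subset; case: (eQ p pe).
have [w Pw [wb we]] := dQ p pd.
have w0 : w.2.2 = 0.
  by have [y []] := branch_image hp; rewrite Pw => -[<-].
have [q [hq qp wE]] := branch_image_in_box hp pn Pw (wb w0).
have qe : `|p1s - q| < e by move: we; rewrite wE.
have hpq : hb c H p2H p0b q = hb c H p2H p0b p.
  by rewrite /hb -wE; exact: (Pcoord_energy hs Pw).
case: (ltgtP p q) => [lt|lt|E].
- by have := inj _ _ pe qe lt; rewrite hpq eqxx.
- by have := inj _ _ qe pe lt; rewrite hpq eqxx.
- by move: qp; rewrite E eqxx.
Unshelve. all: by end_near. Qed.

(** * Bifurcation at fixed energy *)

Variables (D : set (seccoord R n)) (W : set (R * pqcoord R n)).
Variable p0f : R * pqcoord R n -> R.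
Hypothesis hfp_pos : 0 < (hfp c H p1c p2c)^`() p0s.
Hypothesis hb_pos : 0 < (hb c H p2H p0b)^`(2) p1s.
Hypothesis hlev : level_param c H r D W p0f.
Hypothesis Dxs : D (xb p1s).

Notation E := (energy c H).
Notation hs0 := (E (xb p1s)).

Lemma open_cover : open D. Proof. by case: hlev. Qed.

(** Energy levels are graphs over (p, q). *)
Lemma level_inj x x' : D x -> D x' -> E x = E x' -> x.2 = x'.2 -> x = x'.
Proof.
have [_ _ _ _ lx] := hlev => /lx[_ e] /lx[_ e'] eE e2.
move: e e'; rewrite /smap eE e2 => -> e.
by case: x x' e2 e {eE} => [a b] [a' b'] /= -> ->.
Qed.

Lemma iterates_of_levelmap (g : R -> pqcoord R n -> option (pqcoord R n))
    (N : set (seccoord R n)) p x :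
  (forall y, N y -> g (E y) y.2 = omap snd (Pc 2 y)) -> cdom c x ->
  (forall i, (i <= p)%N -> exists2 y, Pc (2 * i) x = Some y & N y) ->
  piter p (g (E x)) x.2 = omap snd (Pc (2 * p) x).
Proof.
move=> gN cx; elim: p => [|p IH] hN; first by rewrite muln0 (Pcoord0 hs cx).
rewrite piterS IH => [|i ip]; last by apply: hN; rewrite ltnW.
have [y Py Ny] := hN p (leqnSn p).
by rewrite Py /= -(Pcoord_energy hs Py) gN// (PcoordD hs _ Py) mulnS.
Qed.

Lemma iterates_near m (Q : set (seccoord R n)) : (\forall x \near xb p1s, Q x) ->
  \forall x \near xb p1s, forall i, (i <= m)%N ->
    exists2 y, Pc (2 * i) x = Some y & Q y.
Proof.
move=> nQ.
have fixed i : Pc (2 * i) (xb p1s) = Some (xb p1s).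
  rewrite mulnC branch_start; apply: (Pcoord_multiple_fixed hs).
  by have [] := fixed_curve_fixed P0s.
elim: m => [|m IH].
  have := Pcoord_near (fixed 0%N) nQ; apply: filterS => x h i.
  by rewrite leqn0 => /eqP ->.
have := Pcoord_near (fixed m.+1) nQ; apply: filter_app; near=> x => h i.
rewrite leq_eqVlt => /predU1P[->//|].
have hx : forall i, (i <= m)%N -> exists2 y, Pc (2 * i) x = Some y & Q y by near: x.
exact: hx.
Unshelve. all: by end_near. Qed.

Lemma hfp_start : hfp c H p1c p2c p0s = hs0.
Proof. by rewrite /hfp branch_start. Qed.

(** The first k iterates under P^2 of a point near x^* satisfy Q, in particular
    they are covered by the parametrization of the energy levels; so iterating
    in (p, q) at fixed energy h amounts to iterating P^2 on the section, and
    equal (p, q) means equal points. *)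
Lemma levelmap_chart (g : R -> pqcoord R n -> option (pqcoord R n))
    (Q : set (seccoord R n)) :
  (forall x, Q x -> D x /\ g (E x) x.2 = omap snd (Pc 2 x)) ->
  (\forall x \near xb p1s, Q x) ->
  exists (A : set R) (U : set (pqcoord R n)),
    [/\ nbhs hs0 A, open U, U (xb p1s).2 & forall h y, A h -> U y ->
    [/\ Q (p0f (h, y), y), E (p0f (h, y), y) = h,
      forall p, (p <= k)%N -> exists2 z, Pc (2 * p) (p0f (h, y), y) = Some z & Q z,
      forall p, (p <= k)%N ->
        piter p (g h) y = omap snd (Pc (2 * p) (p0f (h, y), y)) &
      forall p, (p <= k)%N -> piter p (g h) y = Some y <->
        Pc (2 * p) (p0f (h, y), y) = Some (p0f (h, y), y)]].
Proof.
move=> QD nQ; have [_ Dc [oW CW] WP DP] := hlev.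
pose N x := forall i, (i <= k)%N -> exists2 y, Pc (2 * i) x = Some y & Q y.
have nN : \forall x \near xb p1s, N x by exact: iterates_near.
have Ws : W (smap c H (xb p1s)) by case: (DP _ Dxs).
have nW : \forall w \near smap c H (xb p1s), W w /\ N (p0f w, w.2).
  have Cl : Cr 0 W (fun w => (p0f w, w.2)).
    have C1 : Cr 0 W p0f := Cr_leq (leq0n r) CW.
    have C2 : Cr 0 W (fun w => w.2) := Cr_snd oW (Cr_id 0 W).
    exact: (Cr_pair oW C1 C2).
  near=> w; split; first by near: w; exact: open_nbhs_nbhs.
  near: w; apply: (Cl _ Ws N); rewrite /= (DP _ Dxs).2.
  by rewrite -surjective_pairing.
have [[A B] /= [nA nB] AB] := nW.
exists A, B°; split=> //; first exact: open_interior.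
move=> h y Ah /interior_subset By; have [/= Wh Nx] := AB (h, y) (conj Ah By).
have [/= Dx Ex] := WP _ Wh; have cx := Dc _ Dx.
have iter p : (p <= k)%N ->
    piter p (g h) y = omap snd (Pc (2 * p) (p0f (h, y), y)).
  move=> pk; have := @iterates_of_levelmap g Q p _ _ cx.
  rewrite Ex /=; apply; first by move=> z /QD[].
  by move=> i ip; apply: Nx; exact: leq_trans pk.
split=> //.
  by have [z] := Nx 0%N isT; rewrite muln0 (Pcoord0 hs cx) => -[<-].
move=> p pk; rewrite iter//; split; last by move=> ->.
have [z Pz /QD[Dz _]] := Nx p pk.
rewrite Pz /= => -[zy]; congr Some; apply: level_inj => //.
exact: (Pcoord_energy hs Pz).
Unshelve. all: by end_near. Qed.

(** The family g is only constrained near x^* by comparison with P^2; this covers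
    both readings of f_h^2, as P^2 restricted to an energy level and as f_h
    iterated twice. *)
Lemma tupling_of_local_model (g : R -> pqcoord R n -> option (pqcoord R n)) :
  open (family_dom g) ->
  (\forall x \near xb p1s, g (E x) x.2 = omap snd (Pc 2 x)) ->
  period_tupling r k g (@sym_pred R n) (smap c H (xb p1s)).
Proof.
move=> og ng; have [_ oP0 _ _ _] := hfix.
have [oD _ _ _ DP] := hlev.
have r0 := ltnW r_ge2.
have hfp_pos' : 0 < 'D_1 (hfp c H p1c p2c) p0s by rewrite -derive1E.
have hb_pos' : 0 < 'D_1 (fun p => 'D_1 (hb c H p2H p0b) p) p1s.
  rewrite (_ : (fun p => _) = derive1 (hb c H p2H p0b)); first by rewrite -derive1E.
  by apply/funext => p; rewrite derive1E.
have [e1 [hmin [hmax1 [bf [[e10 hr1] bfs bfP bfK Cbf]]]]] :=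
  regular_branch r0 oP0 Cr_hfp P0s hfp_pos'.
have [e2 [hmax2 [b1 [b2 [[e20 hr2 e2P] bmin bP bK [cb1 cb2 Cb1 Cb2]]]]]] :=
  fold_branches r_ge2 (open_interior P1) Cr_hb P1s_interior hb_critical hb_pos'.
rewrite hfp_start in hr1 bfs.
have hbE : hb c H p2H p0b p1s = hs0 by [].
rewrite hbE in hr2 bmin bP bK cb1 cb2 Cb1 Cb2.
(* Q holds the constraints under which the parameter of a point on either
   curve can be recovered from its energy *)
pose Q x := [/\ D x, g (E x) x.2 = omap snd (Pc 2 x), (x.2.2 = 0 -> box x),
  p0s - e1 <= x.1 <= p0s + e1 & p1s - e2 <= x.2.1.1 <= p1s + e2].
have nQ : \forall x \near xb p1s, Q x.
  near=> x; split.
  - by near: x; exact: open_nbhs_nbhs.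
  - by near: x.
  - by near: x; exact: box_near.
  - near: x; apply: (@near_p0 _ _ _ (fun t => p0s - e1 <= t <= p0s + e1)) => /=.
    rewrite -p0sE; exists e1 => // t /=; rewrite ltr_norml; lra.
  - near: x; apply: (@near_p1 _ _ _ (fun t => p1s - e2 <= t <= p1s + e2)) => /=.
    exists e2 => // t /=; rewrite ltr_norml; lra.
have QD x : Q x -> D x /\ g (E x) x.2 = omap snd (Pc 2 x) by case.
have [A [U [nA oU Us chart]]] := levelmap_chart QD nQ.
have unlift x : D x -> (p0f (E x, x.2), x.2) = x.
  by move=> /DP[_ /= ->]; rewrite -surjective_pairing.
have fix_lift h y p : A h -> U y -> (p <= k)%N ->
    piter p (g h) y = Some y <->
    Pc (2 * p) (p0f (h, y), y) = Some (p0f (h, y), y).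
  by move=> Ah Uy pk; have [_ _ _ _ ->] := chart h y Ah Uy.
have box_lift h y : A h -> U y -> y.2 = 0 -> [/\ box (p0f (h, y), y),
    p0s - e1 <= p0f (h, y) <= p0s + e1 & p1s - e2 <= y.1.1 <= p1s + e2].
  by move=> Ah Uy y0; have [[_ _ /(_ y0) ? ? ?] _ _ _ _] := chart h y Ah Uy.
(* for energies near hs0 the three curves stay in the chart *)
have nDU : \forall x \near xb p1s, D x /\ U x.2.
  near=> x; split; first by near: x; exact: open_nbhs_nbhs.
  by near: x; apply: near_pq; exact: open_nbhs_nbhs.
have hs0in : hs0 \in `]hmin, hmax1[%R by rewrite in_itv.
have cbf : {for hs0, continuous bf} := Cr_continuous Cbf hs0in.
have nfx : \forall t \near bf hs0, D (xfp t) /\ U (xfp t).2.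
  have nDU' : \forall x \near xfp p0s, D x /\ U x.2 by rewrite -branch_start.
  by rewrite bfs; exact: (Cr_continuous Cr_fixed_curve P0s nDU').
have nfb : \forall h \near hs0, D (xfp (bf h)) /\ U (xfp (bf h)).2.
  exact: near_image cbf nfx.
have n1 : \forall h \near hs0, h \in `]hmin, hmax1[%R by exact: near_in_itvoo.
have n2 : \forall h \near hs0, h < hmax2 by exact: lt_nbhsl.
have nf : \forall h \near hs0, [/\ A h, hmin < h < hmax1, h < hmax2 &
    D (xfp (bf h)) /\ U (xfp (bf h)).2].
  near=> h; split.
  - by near: h.
  - have : h \in `]hmin, hmax1[%R by near: h.
    by rewrite in_itv.
  - by near: h.
  - by near: h.
(* at hs0 the branches are only continuous from the right *)
have nb (b : R -> R) : {within `[hs0, hmax2], continuous b} -> b hs0 = p1s ->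
    \forall h \near hs0, hs0 <= h <= hmax2 -> D (xb (b h)) /\ U (xb (b h)).2.
  move=> cb bs; have /subspace_continuousP := cb.
  have hsin : `[hs0, hmax2] hs0 by rewrite /= in_itv/= lexx ltW.
  move=> /(_ hs0 hsin) cbs.
  have nb0 : \forall t \near b hs0, D (xb t) /\ U (xb t).2.
    by rewrite bs; exact: (Cr_continuous Cr_branch P1s_interior nDU).
  have nc : \forall h \near hs0, `[hs0, hmax2] h -> D (xb (b h)) /\ U (xb (b h)).2.
    exact: (cbs [set t | D (xb t) /\ U (xb t).2] nb0).
  near=> h => hh.
  have hi : `[hs0, hmax2] h -> D (xb (b h)) /\ U (xb (b h)).2 by near: h.
  by apply: hi; rewrite /= in_itv.
(* both branches start at the critical point, where the level hs0 is attained
   only once *)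
have bs : b1 hs0 = p1s /\ b2 hs0 = p1s.
  have hh : hs0 <= hs0 <= hmax2 by rewrite lexx ltW.
  have [E1 E2 _ i1 i2] := bP hs0 hh.
  by split; [exact: (bmin _ i1).2|exact: (bmin _ i2).2].
have [d0 /= d00 dQ] : \forall h \near hs0, [/\ A h, hmin < h < hmax1, h < hmax2 &
    D (xfp (bf h)) /\ U (xfp (bf h)).2] /\ (hs0 <= h <= hmax2 ->
    [/\ D (xb (b1 h)), U (xb (b1 h)).2, D (xb (b2 h)) & U (xb (b2 h)).2]).
  have nb1 := nb b1 cb1 bs.1; have nb2 := nb b2 cb2 bs.2.
  apply: (filterS _ (filterI nf (filterI nb1 nb2))) => h [nfh [n1h n2h]].
  split=> [|hh]; first exact: nfh.
  have [u1 v1] := n1h hh; have [u2 v2] := n2h hh; exact: (And4 u1 v1 u2 v2).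
pose nu1 := hs0 - d0 / 2; pose nu2 := hs0 + d0 / 2.
have good h : nu1 <= h <= nu2 -> [/\ A h, hmin < h < hmax1, h < hmax2 &
    D (xfp (bf h)) /\ U (xfp (bf h)).2] /\ (hs0 <= h <= hmax2 ->
    [/\ D (xb (b1 h)), U (xb (b1 h)).2, D (xb (b2 h)) & U (xb (b2 h)).2]).
  by move=> hh; apply: dQ; rewrite /= ltr_norml; move: hh; rewrite /nu1 /nu2; lra.
have d2 : nu1 < hs0 < nu2 by rewrite /nu1 /nu2; lra.
have wid h : hs0 <= h <= nu2 -> nu1 <= h <= nu2.
  by case/andP: d2 => l1 _ /andP[l2 ->]; rewrite (le_trans (ltW l1) l2).
have ltwid h : hs0 < h <= nu2 -> hs0 <= h <= nu2.
  by move=> /andP[/ltW -> ->].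
have lehmax h : nu1 <= h <= nu2 -> hs0 <= h -> hs0 <= h <= hmax2.
  by move=> /good[[_ _ /ltW hm2 _] _] ->.
pose fp h := (xfp (bf h)).2.
pose x1 h := (xb (b1 h)).2; pose x2 h := (xb (b2 h)).2.
have fpP h : nu1 <= h <= nu2 ->
    [/\ P0 (bf h), E (xfp (bf h)) = h & (p0f (h, fp h), fp h) = xfp (bf h)].
  move=> /good[[_ h1 _ [Dh _]] _].
  have /bfP[P0h Eh] : hmin <= h <= hmax1.
    by case/andP: h1 => /ltW -> /ltW ->.
  by split=> //; rewrite -[in RHS](unlift _ Dh) -/(hfp c H p1c p2c (bf h)) Eh.
have brP b h : b = b1 \/ b = b2 -> hs0 <= h <= nu2 ->
    [/\ P1° (b h), E (xb (b h)) = h, U (xb (b h)).2,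
        (p0f (h, (xb (b h)).2), (xb (b h)).2) = xb (b h) & A h].
  move=> be hh; have [[Ah _ _ _] bh] := good h (wid h hh).
  have hh2 : hs0 <= h <= hmax2 by apply: lehmax (wid h hh) _; case/andP: hh.
  have [B1 B2 _ i1 i2] := bP h hh2; have [D1 U1 D2 U2] := bh hh2.
  case: be => ->; (split=> //; first by
    apply: e2P; rewrite /= in_itv).
    by rewrite -[in RHS](unlift _ D1) -/(hb c H p2H p0b (b1 h)) B1.
  by rewrite -[in RHS](unlift _ D2) -/(hb c H p2H p0b (b2 h)) B2.
(* h_fp is injective in the chart, so its point of energy h is unique *)
have on_curve h y q : nu1 <= h <= nu2 -> U y -> y.2 = 0 ->
    P0 q -> (p0f (h, y), y) = xfp q -> y = fp h.
  move=> hh Uy y0 hq xq; have [[Ah h1 _ _] _] := good h hh.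
  have [_ qr _] := box_lift h y Ah Uy y0; have [_ Eh _ _ _] := chart h y Ah Uy.
  have pq : p0f (h, y) = q by case: xq.
  have hfq : hfp c H p1c p2c q = h by rewrite /hfp -xq.
  have /(_ q) := bfK; rewrite hfq => bq.
  have hm : hmin <= h <= hmax1 by case/andP: h1 => /ltW -> /ltW ->.
  by rewrite /fp bq//; [rewrite -xq|rewrite -pq].
(* a point of the branch has energy at least hs0, and only the start has
   energy hs0 *)
have on_branch h y q : nu1 <= h <= nu2 -> U y -> y.2 = 0 ->
    P1 q -> (p0f (h, y), y) = xb q ->
    [/\ hs0 <= h, h = hs0 -> y = fp h & y = x1 h \/ y = x2 h].
  move=> hh Uy y0 hq xq; have [[Ah h1 h2' _] _] := good h hh.
  have [_ _ qr] := box_lift h y Ah Uy y0; have [_ Eh _ _ _] := chart h y Ah Uy.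
  have yq : y.1.1 = q by case: xq => _ ->.
  rewrite yq in qr; have hbq : hb c H p2H p0b q = h by rewrite /hb -xq.
  have [hq1 hq2] := bmin q qr; rewrite hbq in hq1 hq2; split=> //.
    by move=> hE; rewrite /fp hE bfs -branch_start -(hq2 hE) -xq.
  have := bK q qr; rewrite hbq => -[|qE|qE]; first exact: lehmax.
    by left; rewrite /x1 -qE -xq.
  by right; rewrite /x2 -qE -xq.
have fp_fix h p : nu1 <= h <= nu2 -> (p <= k)%N ->
    Fix (piter p (g h)) U (@sym_pred R n) (fp h).
  move=> hh pk; have [[Ah _ _ [_ Uf]] _] := good h hh.
  have [P0h _ xE] := fpP h hh; split=> //.
  apply/(fix_lift _ _ _ Ah Uf pk); rewrite xE mulnC.
  by apply: (Pcoord_multiple_fixed hs); case: (fixed_curve_fixed P0h).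
have br_fix b h : b = b1 \/ b = b2 -> hs0 <= h <= nu2 ->
    Fix (piter k (g h)) U (@sym_pred R n) (xb (b h)).2.
  move=> be hh; have [/interior_subset P1h _ Ub xE Ah] := brP b h be hh.
  split=> //.
  apply/(fix_lift _ _ _ Ah Ub (leqnn k)); rewrite xE.
  by apply/(box_fixed (branch_box P1h)); right; exists (b h).
have fix_low h p : nu1 <= h <= nu2 -> (1 <= p < k)%N ->
    Fix (piter p (g h)) U (@sym_pred R n) = [set fp h].
  move=> hh pk; have [[Ah _ _ _] _] := good h hh.
  have pk' : (p <= k)%N by case/andP: pk => _ /ltnW.
  apply/seteqP; split=> [y [Uy /(fix_lift _ _ _ Ah Uy pk') Py y0]|_ ->];
    last exact: fp_fix.
  have [by' _ _] := box_lift h y Ah Uy y0.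
  have /(low_period_fixed pk by')[q hq xq] := Py.
  exact: on_curve xq.
have fix_k h y : nu1 <= h <= nu2 -> Fix (piter k (g h)) U (@sym_pred R n) y ->
    y = fp h \/ [/\ hs0 <= h, h = hs0 -> y = fp h & y = x1 h \/ y = x2 h].
  move=> hh [Uy Py y0]; have [[Ah _ _ _] _] := good h hh.
  have [by' _ _] := box_lift h y Ah Uy y0.
  have /(fix_lift _ _ _ Ah Uy (leqnn k))/(box_fixed by') := Py.
  by case=> -[q hq xq]; [left; exact: on_curve xq|right; exact: on_branch xq].
have bs_lt h : hs0 < h <= nu2 -> b1 h < p1s < b2 h.
  move=> hh; have hh' := ltwid h hh.
  have hh2 : hs0 <= h <= hmax2 by apply: lehmax (wid h hh') _; case/andP: hh'.
  have [B1 B2 /andP[t1 t2] _ _] := bP h hh2.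
  rewrite !lt_neqAle t1 t2 !andbT; apply/andP; split; apply/eqP => bE.
    by move: B1 hh; rewrite bE hbE => ->; rewrite ltxx.
  by move: B2 hh; rewrite -bE hbE => ->; rewrite ltxx.
have fp_ne b h : b = b1 \/ b = b2 -> hs0 < h <= nu2 -> fp h != (xb (b h)).2.
  move=> be hh; have hh' := ltwid h hh.
  have [P1h _ Ub xE Ah] := brP b h be hh'.
  have [P0h _ xE'] := fpP h (wid h hh').
  apply/eqP => fE; have := bs_lt h hh.
  have : b h = p1s by apply: (branch_meets_curve P0h); rewrite -xE -fE.
  by case: be => -> ->; rewrite ltxx ?andbF.
have x12 h : hs0 < h <= nu2 -> x1 h != x2 h.
  move=> /bs_lt/andP[lt1 lt2]; apply/eqP => /(congr1 (fun y => y.1.1))/= bE.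
  by move: (lt_trans lt1 lt2); rewrite bE ltxx.
(* P^k maps a point of the branch to a different point of the branch with the
   same energy, and there is only one such point in the chart *)
have swap b b' h : (b = b1 /\ b' = b2) \/ (b = b2 /\ b' = b1) ->
    hs0 < h <= nu2 -> piter k./2 (g h) (xb (b h)).2 = Some (xb (b' h)).2.
  move=> be hh; have hh' := ltwid h hh.
  have be' : b = b1 \/ b = b2 by case: be => -[-> _]; [left|right].
  have [/interior_subset P1h Eb Ub xE Ah] := brP b h be' hh'.
  have kk : (k./2 <= k)%N by rewrite -divn2 leq_div.
  have [_ _ Nx it _] := chart h _ Ah Ub; rewrite xE in Nx.
  rewrite (it _ kk) xE mulnC half_k.
  have [y Py [Dy _ yb _ yr]] := Nx _ kk; move: Py; rewrite mulnC half_k => Py.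
  have [y' []] := branch_image P1h; rewrite Py => -[<-] y0 _ _ _.
  have bn : b h != p1s.
    have /andP[lt1 lt2] := bs_lt h hh.
    by case: be' => ->; [rewrite lt_eqF|rewrite gt_eqF].
  have [q [hq qn yE]] := branch_image_in_box P1h bn Py (yb y0).
  rewrite /= yE; suff -> : q = b' h by [].
  have Eq : hb c H p2H p0b q = h.
    by rewrite /hb -yE (Pcoord_energy hs Py).
  have qr : p1s - e2 <= q <= p1s + e2 by move: yr; rewrite yE.
  have hh2 : hs0 <= h <= hmax2 by apply: lehmax (wid h hh') _; case/andP: hh'.
  have := bK q qr; rewrite Eq => -[//|qE|qE].
    by case: be qn => -[-> ->]; rewrite qE ?eqxx.
  by case: be qn => -[-> ->]; rewrite qE ?eqxx.
have Cfp : Cr r `]hmin, hmax1[ (fun h => (xfp (bf h)).2).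
  have oI : open (`]hmin, hmax1[ : set R) by exact: interval_open.
  apply: (Cr_snd oI); apply: (@Cr_comp _ _ _ _ _ _ P0 bf xfp) => //.
  - exact: finite_coords_R.
  - move=> h; rewrite /= in_itv/= => /andP[l1 l2].
    have hm : hmin <= h <= hmax1 by rewrite !ltW.
    by have [P0h _] := bfP h hm.
  - exact: Cr_fixed_curve.
have Cbr b : b = b1 \/ b = b2 -> Cr r `]hs0, nu2[ (fun h => (xb (b h)).2).
  move=> be; have oI : open (`]hs0, nu2[ : set R) by exact: interval_open.
  have sI : `]hs0, nu2[ `<=` `]hs0, hmax2[.
    move=> h; rewrite /= !in_itv/= => /andP[l1 l2]; rewrite l1 /=.
    have hh : hs0 <= h <= nu2 by rewrite !ltW.
    by have [[_ _ -> _] _] := good h (wid h hh).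
  apply: (Cr_snd oI); apply: (@Cr_comp _ _ _ _ _ _ P1° b xb) => //.
  - exact: finite_coords_R.
  - move=> h; rewrite /= in_itv/= => /andP[l1 l2].
    have hh : hs0 <= h <= nu2 by rewrite !ltW.
    by have [P1h _ _ _ _] := brP b h be hh.
  - by case: be => ->; [exact: Cr_sub sI Cb1|exact: Cr_sub sI Cb2].
  - exact: Cr_branch.
have U_int y : U y -> U° y by move=> Uy; exact: open_nbhs_nbhs.
have in_hh h : nu1 <= h <= nu2 -> h \in `]hmin, hmax1[%R.
  by move=> /good[[_ hm _ _] _]; rewrite in_itv.
have is1 : b1 = b1 \/ b1 = b2 by left.
have is2 : b2 = b1 \/ b2 = b2 by right.
have cont_br b : b = b1 \/ b = b2 ->
    {within `[hs0, nu2], continuous (fun h => (xb (b h)).2)}.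
  move=> be; have cb : {within `[hs0, hmax2], continuous b} by case: be => ->.
  apply/subspace_continuousP => h hh; have hh' := hh.
  rewrite /= in_itv/= in hh'.
  have [P1h _ _ _ _] := brP b h be hh'.
  have Cx : Cr r P1° (fun p => (xb p).2).
    by apply: (Cr_snd _ Cr_branch); exact: open_interior.
  have cx : {for b h, continuous (fun p => (xb p).2)} := Cr_continuous Cx P1h.
  have sub : `[hs0, nu2] `<=` `[hs0, hmax2].
    move=> t; rewrite /= !in_itv/= => tt.
    by apply: lehmax (wid t tt) _; case/andP: tt.
  have /subspace_continuousP/(_ h hh) cb' := continuous_subspaceW sub cb.
  exact: (cvg_comp _ _ cb' cx).
have fix_k_set h : hs0 <= h <= nu2 ->
    Fix (piter k (g h)) U (@sym_pred R n) = [set fp h; x1 h; x2 h].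
  move=> hh; apply/seteqP; split=> [y /(fix_k h y (wid h hh))|].
    by case=> [->|[_ _ [->|->]]]; [left; left|left; right|right].
  move=> _ [[->|->]|->]; [|exact: br_fix is1 hh|exact: br_fix is2 hh].
  by apply: fp_fix => //; exact: wid.
have memI h : (h \in `[nu1, nu2]) -> nu1 <= h <= nu2.
  by rewrite inE /= in_itv.
split=> //; first exact: ltnW k_gt1.
  (* the fixed point itself belongs to the domain *)
  have [z Pz _] := nbhs_singleton (@iterates_near 1 setT filterT) 1%N isT.
  by rewrite /family_dom /= (nbhs_singleton ng) -[2%N]/(2 * 1)%N Pz.
exists nu1, nu2, U, fp, x1, x2; split.
- split.
    move=> [h y] [/= /memI hh Uy]; have [[Ah _ _ _] _] := good h hh.
    have [_ _ Nx it _] := chart h y Ah Uy.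
    rewrite /family_dom /= -[g h y]/(piter 1 (g h) y) (it 1%N (ltnW k_gt1)).
    by have [z ->] := Nx 1%N (ltnW k_gt1).
  suff nV : nbhs (smap c H (xb p1s)) ([set` `[nu1, nu2]] `*` U) by exact: nV.
  exists ([set` `[nu1, nu2]], U); last by [].
  split=> /=; last exact: U_int.
  have d2' : hs0 \in `]nu1, nu2[%R by rewrite in_itv.
  have nI : \forall h \near hs0, h \in `]nu1, nu2[%R by exact: near_in_itvoo.
  near=> h; apply/mem_set; have : h \in `]nu1, nu2[%R by near: h.
  by rewrite /= !in_itv/= => /andP[/ltW -> /ltW ->].
- split=> h hh; apply: U_int.
  + by have [[_ _ _ []] _] := good h hh.
  + by have [_ _ ?] := brP b1 h is1 hh.
  + by have [_ _ ?] := brP b2 h is2 hh.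
- split.
  + split.
      apply: continuous_in_subspaceT => h /memI/in_hh hh.
      exact: (Cr_continuous Cfp hh).
    apply: Cr_sub Cfp => h; rewrite /= in_itv/= => /andP[l1 l2].
    by apply: in_hh; rewrite !ltW.
  + by split; [exact: cont_br|exact: Cbr].
  + by split; [exact: cont_br|exact: Cbr].
  + have fps : fp hs0 = (xb p1s).2 by rewrite /fp bfs -branch_start.
    have x1s : x1 hs0 = (xb p1s).2 by rewrite /x1 bs.1.
    have x2s : x2 hs0 = (xb p1s).2 by rewrite /x2 bs.2.
    by split; [exact: x1s|exact: x2s|exact: fps].
- split.
  + move=> h p /andP[h1 h2'] /andP[p1 pk].
    have hh : nu1 <= h <= nu2.
      by rewrite h1 (le_trans h2')// ltW//; case/andP: d2.
    have [pk'|kp] := ltnP p k; first by apply: fix_low => //; rewrite p1.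
    have -> : p = k by apply/eqP; rewrite eqn_leq pk.
    apply/seteqP; split=> [y /(fix_k h y hh)[//|[h3' e _]]|_ ->]; last exact: fp_fix.
    by apply: e; apply/eqP; rewrite eq_le h2' h3'.
  + by move=> h p hh; apply: fix_low; exact: wid.
  + exact: fix_k_set.
  + move=> h hh; have hh' := ltwid h hh.
    rewrite (fix_k_set h hh').
    by apply: card_three; [exact: fp_ne is1 hh|exact: fp_ne is2 hh|exact: x12].
- by move=> _ h hh; split; apply: swap => //; [left|right].
Unshelve. all: by end_near. Qed.

Lemma levelmap_Cr m : exists (A : set (R * pqcoord R n))
    (F : R * pqcoord R n -> pqcoord R n),
  [/\ open A, Cr 0 A F,
    forall w, isSome (levelmap c P W p0f m w.1 w.2) <-> A w
    & forall w, A w -> levelmap c P W p0f m w.1 w.2 = Some (F w)].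
Proof.
have [_ _ [oW CW] _ _] := hlev; have [A [F [oA CF PA FA]]] := Pcoord_Cr hs c m.
pose l (w : R * pqcoord R n) : seccoord R n := (p0f w, w.2).
have Cl : Cr 0 W l.
  have C1 : Cr 0 W p0f := Cr_leq (leq0n r) CW.
  have C2 : Cr 0 W (fun w => w.2) := Cr_snd oW (Cr_id 0 W).
  exact: (Cr_pair oW C1 C2).
have oB := open_preimage_on oW Cl oA.
have lE w : (W `&` l @^-1` A) w -> levelmap c P W p0f m w.1 w.2 = Some (F (l w)).2.
  by case: w => h y [Ww /= Al]; rewrite /levelmap asboolT// (FA _ Al).
exists (W `&` l @^-1` A), (fun w => (F (l w)).2); split; [exact: oB| | |exact: lE].
  apply: (Cr_snd oB); apply: (@Cr_comp _ _ _ _ _ _ A l F) => //.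
  - exact: finite_coords_seccoord.
  - by move=> w [].
  - by apply: Cr_sub Cl => w [].
  - exact: Cr_leq CF.
move=> w; split; last by move=> /lE ->.
case: w => h y; rewrite /levelmap /=; case: asboolP => // Ww Pw.
split=> //; apply/PA; move: Pw; rewrite /l /=.
by case: (Pcoord _ _ _ _).
Qed.

Lemma open_levelmap m : open (family_dom (levelmap c P W p0f m)).
Proof.
have [A [F [oA _ PA _]]] := levelmap_Cr m.
by rewrite (_ : family_dom _ = A)//; apply/seteqP; split=> w /PA.
Qed.

Lemma open_levelmap_twice :
  open (family_dom (fun h => piter 2 (levelmap c P W p0f 1 h))).
Proof.
have [A [F [oA CF PA FA]]] := levelmap_Cr 1.
have C1 : Cr 0 A (fun w : R * pqcoord R n => w.1) := Cr_fst oA (Cr_id 0 A).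
have := open_preimage_on oA (Cr_pair oA C1 CF) oA.
rewrite (_ : family_dom _ = A `&` (fun w => (w.1, F w)) @^-1` A)//.
apply/seteqP; split=> -[h y]; rewrite /family_dom /= piterSr.
  case E1: (levelmap _ _ _ _ 1 h y) => [y'|]//= sy'.
  have Aw : A (h, y) by apply/PA; rewrite /= E1.
  split=> //=; apply/PA => /=; have := FA _ Aw; rewrite /= E1 => -[<-].
  exact: sy'.
move=> [Aw /= Aw']; have := FA _ Aw; rewrite /= => ->.
have := FA _ Aw'; rewrite /= => E2.
by rewrite /= -[piter 1 _ _]/(levelmap _ _ _ _ _ _ _) E2.
Qed.

(** At a point of D the parametrization of the levels returns the point itself. *)
Lemma levelmap_energy m x : D x -> levelmap c P W p0f m (E x) x.2 = omap snd (Pc m x).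
Proof.
have [_ _ _ _ lx] := hlev => /lx[Wx ex].
by rewrite /levelmap asboolT// -/(smap c H x) ex -surjective_pairing.
Qed.

Lemma tupling_levelmap :
  period_tupling r k (levelmap c P W p0f 2) (@sym_pred R n) (smap c H (xb p1s)).
Proof.
apply: tupling_of_local_model; first exact: open_levelmap.
near=> x; apply: levelmap_energy; near: x; apply: open_nbhs_nbhs.
by split=> //; exact: open_cover.
Unshelve. all: by end_near. Qed.

(** If P x^* is covered by the parametrization, so are the images of points near
    x^*; near x^* the intermediate point of f_h^2 is then the one of P^2. *)
Lemma tupling_levelmap_twice : (exists2 y, Pc 1 (xb p1s) = Some y & D y) ->
  period_tupling r k (fun h => piter 2 (levelmap c P W p0f 1 h))
    (@sym_pred R n) (smap c H (xb p1s)).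
Proof.
move=> [y Py Dy]; apply: tupling_of_local_model; first exact: open_levelmap_twice.
have nD x : D x -> nbhs x D.
  by move=> Dx; apply: open_nbhs_nbhs; split=> //; exact: open_cover.
have := Pcoord_near Py (nD _ Dy); apply: filter_app.
have := nD _ Dxs; apply: filterS => x Dx [z Pz Dz].
rewrite piterSr (levelmap_energy _ Dx) Pz /=.
rewrite -(Pcoord_energy hs Pz) -[2%N]/(1 + 1)%N -(PcoordD hs _ Pz).
exact: levelmap_energy.
Qed.

End SymmetricFixedPoints.

Unset Implicit Arguments.

Theorem theorem15 (R : realType) (n r k : nat)
    (H : phase R n -> R) (rho rhoV : phase R n -> phase R n)
    (S : set (phase R n)) (P : phase R n -> option (phase R n))
    (c : local_coords S rho)
    (P0 P1 : set R) (P2 : set 'rV[R]_n.-1)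
    (p1c : R -> R) (p2c : R -> 'rV[R]_n.-1)
    (p2H : R * R -> 'rV[R]_n.-1) (p0b : R -> R)
    (p0s p1s : R)
    (D : set (seccoord R n)) (W : set (R * pqcoord R n))
    (p0f : R * pqcoord R n -> R) :
  (0 < n)%N -> (2 <= r <= 3)%N -> (1 < k)%N -> ~~ odd k ->
  hamiltonian_setting H rho rhoV S P ->
  fixed_curve c P r k P0 P1 P2 p1c p2c ->
  HC2 c P r k P0 P1 P2 p1c p2H ->
  HC3 c P r k P0 P1 p1c p2H p0b ->
  HC4 c P k P0 P1 p1c p2H ->
  P0 p0s -> P1 p1s -> p1s = p1c p0s -> p0s = p0b p1s ->
  let xs : seccoord R n := sympt p0s p1s (p2H (p0s, p1s)) in
  transverse_near c H xs ->
  (fun t => energy c H (t, xs.2))^`() p0s != 0 ->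
  0 < (hfp c H p1c p2c)^`() p0s ->
  0 < (hb c H p2H p0b)^`(2) p1s ->
  level_param c H r D W p0f -> D xs ->
  period_tupling r k (levelmap c P W p0f 2) (@sym_pred R n) (smap c H xs) /\
  ((exists2 y, Pcoord c P 1 xs = Some y & D y) ->
   period_tupling r k (fun h => piter 2 (levelmap c P W p0f 1 h))
     (@sym_pred R n) (smap c H xs)).
Proof.
move=> _ r23 k1 ke hs hfix h2 h3 h4 P0s P1s p1sE p0sE xs _ _ hfp hb hlev Dxs.
have xsE : xs = xbH p2H p0b p1s by rewrite /xbH -p0sE.
rewrite xsE in Dxs *; split.
  exact: (tupling_levelmap r23 k1 ke hs hfix h2 h3 h4 P0s P1s p1sE p0sE
    hfp hb hlev Dxs).
exact: (tupling_levelmap_twice r23 k1 ke hs hfix h2 h3 h4 P0s P1s p1sE p0sE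
  hfp hb hlev Dxs).
Qed.
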